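(* Let $\Omega\subseteq\mathbb{R}^3$ be a bounded domain with sufficiently smooth boundary, with boundary partition $\Gamma_e,\Gamma_g,\Gamma_r$ and lifting function $\chi$ as in the context. Let the real material parameters $c^E$, $e$, $\epsilon^S$ have the form given in the context, with $c^E$ and $\epsilon^S$ symmetric and positive definite. Let $\rho>0$ and $\alpha,\beta>0$ (strictly). Let $u_0\in H^1_{\mathcal B}(\Omega)$, $u_1\in L^2(\Omega)$, and let $\phi^e$ be defined on $[0,\infty)$ with $\phi^e\in H^1(0,T;H^{1/2}(\Gamma_e))$ for every $T>0$. Suppose additionally that there exists $t_0\in\mathbb{R}$, $t_0\ge0$, such that $\phi^e(t)=0$ for all $t\ge t_0$. Let $m\in\mathbb{N}$ and let $(u_m,\phi_m)$ be the Galerkin approximation defined in the context. Then, as $t\to\infty$, $$\|\dot u_m(t)\|_{L^2(\Omega)}\to0,\qquad \|\mathcal B u_m(t)\|_{L^2(\Omega)}\to0,\qquad \|\phi_m(t)\|_{H^1_0(\Omega)}\to0.$$ Furthermore, the energy of the system $$\eta(t)=\|\dot u_m(t)\|^2_{L^2(\Omega)}+\|u_m(t)\|^2_{H^1_{\mathcal B}(\Omega)}+\|\phi_m(t)\|^2_{H^1_0(\Omega)}$$ converges to a constant: $\eta(t)\to c\in\mathbb{R}^{+}$ as $t\to\infty$.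
   Context: Domain: $\Gamma:=\partial\Omega$ is the disjoint union of nonempty subsets $\Gamma_e$ (electrically excited), $\Gamma_g$ (grounded) and $\Gamma_r=\Gamma\setminus(\Gamma_e\cup\Gamma_g)$, each of positive two-dimensional measure. ''Sufficiently smooth boundary'' means that the trace theorem applies to $\Omega$ (a $C^1$ boundary is sufficient). A function $\chi\in H^1(\Omega)$ with $\chi|_{\Gamma_g}=0$ and $\chi|_{\Gamma_e}=1$ is fixed once and for all. The excitation $\phi^e(t)$ is a prescribed value at each time $t$: it is constant along $\Gamma_e$, so $\phi^e(t)\in\mathbb{R}$ is identified with the corresponding constant function on $\Gamma_e$. Material parameters: $c^E\in\mathbb{R}^{6\times6}$, $\epsilon^S\in\mathbb{R}^{3\times 3}$, $e\in\mathbb{R}^{3\times6}$ are constant real matrices of the form $$c^E=\begin{pmatrix} c_{11}&c_{12}&c_{13}&0&0&0 \\ c_{12}&c_{11}&c_{13}&0&0&0 \\ c_{13}&c_{13}&c_{33}&0&0&0 \\ 0&0&0&c_{44}&0&0 \\ 0&0&0&0&c_{44}&0 \\ 0&0&0&0&0&\tfrac12(c_{11}-c_{12}) \end{pmatrix},\quad \epsilon^S=\begin{pmatrix} \epsilon_{11}&0&0 \\ 0&\epsilon_{11}&0 \\ 0&0&\epsilon_{33} \end{pmatrix},\quad e=\begin{pmatrix} 0&0&0&0&e_{15}&0 \\ 0&0&0&e_{15}&0&0 \\ e_{13}&e_{13}&e_{33}&0&0&0 \end{pmatrix}.$$ Symmetric gradient in Voigt notation, acting on $\mathbb{R}^3$-valued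 functions of $(x,y,z)$ (all derivatives distributional): $$\mathcal B=\begin{pmatrix} \partial_x&0&0 \\ 0&\partial_y&0 \\ 0&0&\partial_z \\ 0&\partial_z&\partial_y \\ \partial_z&0&\partial_x \\ \partial_y&\partial_x&0 \end{pmatrix}.$$ Spaces: $\|\sigma\|_{L^2(\Omega)}^2=\int_\Omega\sigma^T\sigma\,d\Omega$ for vector-valued $\sigma$ of any dimension. $H^1_{\mathcal B}(\Omega)=\{\sigma:\Omega\to\mathbb{R}^3:\ \|\sigma\|^2_{H^1_{\mathcal B}(\Omega)}:=\|\sigma\|_{L^2(\Omega)}^2+\|\mathcal B\sigma\|_{L^2(\Omega)}^2<\infty\}$. $H^1_0(\Omega)$ is the space of scalar $\sigma\in H^1(\Omega)$ with $\sigma|_\Gamma=0$, with the $H^1(\Omega)$ norm. Dots denote time derivatives, and $\langle\cdot,\cdot\rangle$ denotes the $L^2(\Omega)$ inner product. Galerkin approximation: let $(v_j)_{j\in\mathbb{N}}\subset H^1_{\mathcal B}(\Omega)$ and $(w_j)_{j\in\mathbb{N}}\subset H^1_0(\Omega)$ be linearly independent families such that, with $V_m=\operatorname{span}\{v_1,\dots,v_m\}$ and $W_m=\operatorname{span}\{w_1,\dots,w_m\}$, the union $\bigcup_m V_m$ is dense in $H^1_{\mathcal B}(\Omega)$ and $\bigcup_m W_m$ is dense in $H^1_0(\Omega)$. The Galerkin approximation is the unique pair $u_m\in C^2([0,\infty);V_m)$, $\phi_m\in C([0,\infty);W_m)$ such that for all $t\ge0$ and all $(v,w)\in V_m\times W_m$,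 $$\begin{aligned}&\langle\rho\,\ddot u_m(t),v\rangle+\alpha\langle\rho\,\dot u_m(t),v\rangle+\langle c^E\mathcal B u_m(t),\mathcal B v\rangle+\beta\langle c^E\mathcal B\dot u_m(t),\mathcal B v\rangle\\ &+\langle e^T\nabla\phi_m(t),\mathcal B v\rangle+\langle e\,\mathcal B u_m(t),\nabla w\rangle-\langle\epsilon^S\nabla\phi_m(t),\nabla w\rangle\\ &=-\phi^e(t)\int_\Omega(e^T\nabla\chi)^T\mathcal B v\,d\Omega+\phi^e(t)\int_\Omega(\epsilon^S\nabla\chi)^T\nabla w\,d\Omega,\end{aligned}$$ with initial conditions $u_m(0)=(u_0)_m$ and $\dot u_m(0)=(u_1)_m$, where $(u_0)_m,(u_1)_m\in V_m$ are the orthogonal projections onto $V_m$ of $u_0$ in $H^1_{\mathcal B}(\Omega)$ and of $u_1$ in $L^2(\Omega)$, respectively. Here $\phi_m$ approximates $\phi_0=\phi-\phi^e\chi$, where $\phi$ is the electric potential. *)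

(* Defs.v *)
From HB Require Import structures.
From mathcomp Require Import all_boot all_order all_algebra.
From mathcomp Require Import all_classical all_reals all_analysis.

Set Implicit Arguments.
Unset Strict Implicit.
Unset Printing Implicit Defensive.

Import Order.TTheory GRing.Theory Num.Theory.
Import numFieldNormedType.Exports.

Local Open Scope classical_set_scope.
Local Open Scope ring_scope.

Notation R3 R := (R * R * R)%type.
(* [R3 R] with the measurable structure over which [lebesgue_measure] is defined *)
Notation mR3 R := (measurableTypeR R * measurableTypeR R * measurableTypeR R)%type.

Section Lebesgue3.
Variable R : realType.

Definition leb3 : {measure set (mR3 R) -> \bar R} :=
  ((@lebesgue_measure R \x @lebesgue_measure R) \x @lebesgue_measure R)%E.

Definition crd (i : 'I_3) (p : R3 R) : R :=
  match val i with 0%N => p.1.1 | 1%N => p.1.2 | _ => p.2 end.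

Definition edir (i : 'I_3) : R3 R :=
  ((val i == 0)%N%:R, (val i == 1)%N%:R, (val i == 2)%N%:R).

End Lebesgue3.

(** Two-dimensional Hausdorff measure for the Euclidean distance (the norm that
    the library puts on a product is the max norm). The factor [pi / 4] makes
    it the usual surface area. *)
Section Hausdorff.
Variable R : realType.
Implicit Types U : set (R3 R).

Definition edist (p q : R3 R) : R :=
  Num.sqrt (\sum_(i < 3) (crd i p - crd i q) ^+ 2).

(** 0 is added to the set so that the empty set has diameter 0. *)
Definition ediam U : \bar R :=
  ereal_sup (0%E |` [set (edist z.1 z.2)%:E | z in U `*` U]).

(** Covers with a member of diameter > [d] get weight [+oo], that is, they are
    excluded. *)
Definition gauge2 (d : R) U : \bar R :=
  if (ediam U <= d%:E)%E then ((pi / 4)%:E * ediam U ^+ 2)%E else +oo%E.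

Definition hausdorff2_size (d : R) U : \bar R :=
  ereal_inf [set (\sum_(k <oo) gauge2 d (F k))%E |
             F in [set F : (set (R3 R))^nat | U `<=` \bigcup_k F k]].

Definition hausdorff2 U : \bar R :=
  ereal_sup [set hausdorff2_size d U | d in [set d : R | 0 < d]].

Lemma ediam_ge0 U : (0 <= ediam U)%E.
Proof. by apply: ereal_sup_ubound; left. Qed.

Lemma ediam0 : ediam set0 = 0%E.
Proof.
rewrite /ediam set0X image_set0 setU0.
by rewrite ereal_sup1.
Qed.

Lemma gauge2_ge0 d U : (0 <= gauge2 d U)%E.
Proof.
rewrite /gauge2; case: ifP => // _; apply: mule_ge0.
  by rewrite lee_fin divr_ge0 ?pi_ge0.
by rewrite expe_ge0 ?ediam_ge0.
Qed.

Lemma gauge2_0 d : 0 < d -> gauge2 d set0 = 0%E.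
Proof.
by move=> d0; rewrite /gauge2 ediam0 lee_fin ltW// expeS mul0e mule0.
Qed.

Lemma hausdorff2_sizeE d :
  hausdorff2_size d =
  @mu_ext _ (g_sigma_algebraType [set: set (R3 R)]) R (gauge2 d).
Proof.
apply/funext => U; rewrite /hausdorff2_size /mu_ext; congr (ereal_inf _).
apply/seteqP; split=> [_ [F UF <-]|_ [F [_ UF] <-]]; exists F => //.
by split=> // i; apply: sub_sigma_algebra.
Qed.

Lemma hausdorff2_0 : hausdorff2 set0 = 0%E.
Proof.
apply/eqP; rewrite eq_le; apply/andP; split.
  apply: ge_ereal_sup => _ [d /= d0 <-].
  by rewrite hausdorff2_sizeE mu_ext0//; [exact: gauge2_0|exact: gauge2_ge0].
apply: ereal_sup_ubound; exists 1 => //=.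
by rewrite hausdorff2_sizeE mu_ext0//; [exact: gauge2_0|exact: gauge2_ge0].
Qed.

Lemma hausdorff2_size_ge0 d U : (0 <= hausdorff2_size d U)%E.
Proof. by rewrite hausdorff2_sizeE; apply: mu_ext_ge0; exact: gauge2_ge0. Qed.

Lemma hausdorff2_size_le d U : 0 < d -> (hausdorff2_size d U <= hausdorff2 U)%E.
Proof. by move=> d0; apply: ereal_sup_ubound; exists d. Qed.

Lemma hausdorff2_ge0 U : (0 <= hausdorff2 U)%E.
Proof.
by apply: le_trans (hausdorff2_size_le U ltr01); exact: hausdorff2_size_ge0.
Qed.

Lemma le_hausdorff2 : {homo hausdorff2 : A B / A `<=` B >-> (A <= B)%E}.
Proof.
move=> A B AB; apply: ge_ereal_sup => _ [d /= d0 <-].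
apply: le_trans (hausdorff2_size_le B d0).
by rewrite hausdorff2_sizeE; exact: le_mu_ext.
Qed.

Lemma hausdorff2_sigma_subadditive : sigma_subadditive hausdorff2.
Proof.
move=> F; apply: ge_ereal_sup => _ [d /= d0 <-].
apply: (@le_trans _ _ (\sum_(i <oo) hausdorff2_size d (F i))%E).
  by rewrite hausdorff2_sizeE; apply: mu_ext_sigma_subadditive; exact: gauge2_ge0.
apply: lee_nneseries => i _ *; first exact: hausdorff2_size_ge0.
exact: hausdorff2_size_le.
Qed.

HB.instance Definition _ := isOuterMeasure.Build R (R3 R) hausdorff2
  hausdorff2_0 hausdorff2_ge0 le_hausdorff2 hausdorff2_sigma_subadditive.

Definition hausdorff2_outer : {outer_measure set (R3 R) -> \bar R} := hausdorff2.

Definition surf :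
    {measure set (caratheodory_type hausdorff2_outer) -> \bar R} :=
  hausdorff2_outer.

End Hausdorff.

(* [R3 R] with the sigma-algebra of Hausdorff measurable sets *)
Notation caraR3 R := (caratheodory_type (hausdorff2_outer R)).

Section Spaces.
Variable R : realType.
Variable Om : set (R3 R).

Definition Gam : set (R3 R) := closure Om `\` interior Om.

Definition dotv n (a b : 'cV[R]_n) : R := (a^T *m b) 0 0.

Definition ipL2 n (f g : R3 R -> 'cV[R]_n) : R :=
  \int[leb3 R]_(x in Om) dotv (f x) (g x).

Definition nL2 n (f : R3 R -> 'cV[R]_n) : R := Num.sqrt (ipL2 f f).

Definition L2 n (f : R3 R -> 'cV[R]_n) : Prop :=
  (forall i, measurable_fun (Om : set (mR3 R)) (fun x : mR3 R => f x i 0)) /\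
  (\int[leb3 R]_(x in Om) (dotv (f x) (f x))%:E < +oo)%E.

Definition smooth (psi : R3 R -> R) : Prop :=
  forall s : seq 'I_3,
    let dpsi := foldr (fun i (f : R3 R -> R) => 'D_(edir R i) f) psi s in
    continuous dpsi /\ forall i x, derivable dpsi x (edir R i).

Definition test_fun (psi : R3 R -> R) : Prop :=
  smooth psi /\
  exists K : set (R3 R),
    [/\ compact K, K `<=` Om & forall x, ~ K x -> psi x = 0].

Definition cgrad (psi : R3 R -> R) (x : R3 R) : 'cV[R]_3 :=
  \col_i 'D_(edir R i) psi x.

(** A homogeneous first-order operator with constant coefficients,
    [sum_k A_k d_k], is given by its symbol [A xi = sum_k xi_k A_k].
    Moving the derivatives onto a scalar test function [psi], [g] is the
    distributional image of [f] when
    [int psi g = - int (A (grad psi)) f], componentwise. *)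
Definition weak_image p n (A : 'cV[R]_3 -> 'M[R]_(p, n))
    (f : R3 R -> 'cV[R]_n) (g : R3 R -> 'cV[R]_p) : Prop :=
  forall psi, test_fun psi -> forall i,
    \int[leb3 R]_(x in Om) (psi x * g x i 0) =
    - \int[leb3 R]_(x in Om) (A (cgrad psi x) *m f x) i 0.

Definition Hop p n (A : 'cV[R]_3 -> 'M[R]_(p, n)) (f : R3 R -> 'cV[R]_n) : Prop :=
  L2 f /\ exists g, L2 g /\ weak_image A f g.

(** The distributional image of [f], as a function; meaningful (and unique up
    to a null set) for [f] in [Hop A]. *)
Definition wop p n (A : 'cV[R]_3 -> 'M[R]_(p, n)) (f : R3 R -> 'cV[R]_n) :
    R3 R -> 'cV[R]_p :=
  xget (fun=> 0) [set g | L2 g /\ weak_image A f g].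

Definition ipHop p n (A : 'cV[R]_3 -> 'M[R]_(p, n)) (f g : R3 R -> 'cV[R]_n) : R :=
  ipL2 f g + ipL2 (wop A f) (wop A g).

Definition nHop p n (A : 'cV[R]_3 -> 'M[R]_(p, n)) (f : R3 R -> 'cV[R]_n) : R :=
  Num.sqrt (ipHop A f f).

Definition mx_of_rows p n (rows : seq (seq R)) : 'M[R]_(p, n) :=
  \matrix_(i, j) nth 0 (nth [::] rows i) j.

Definition voigt_symbol (xi : 'cV[R]_3) : 'M[R]_(6, 3) :=
  let x := xi 0 0 in let y := xi 1 0 in let z := xi 2%:R 0 in
  mx_of_rows 6 3
    [:: [:: x; 0; 0];
        [:: 0; y; 0];
        [:: 0; 0; z];
        [:: 0; z; y];
        [:: z; 0; x];
        [:: y; x; 0] ].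

Definition H1B : set (R3 R -> 'cV[R]_3) := Hop voigt_symbol.
Definition Bw : (R3 R -> 'cV[R]_3) -> R3 R -> 'cV[R]_6 := wop voigt_symbol.
Definition ipH1B : (R3 R -> 'cV[R]_3) -> (R3 R -> 'cV[R]_3) -> R :=
  ipHop voigt_symbol.
Definition nH1B : (R3 R -> 'cV[R]_3) -> R := nHop voigt_symbol.

Definition vec1 (f : R3 R -> R) : R3 R -> 'cV[R]_1 := fun x => (f x)%:M.

Definition grad_symbol (xi : 'cV[R]_3) : 'M[R]_(3, 1) := xi.

Definition H1 : set (R3 R -> R) := fun f => Hop grad_symbol (vec1 f).
Definition gradw (f : R3 R -> R) : R3 R -> 'cV[R]_3 := wop grad_symbol (vec1 f).
Definition nH1 (f : R3 R -> R) : R := nHop grad_symbol (vec1 f).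

Definition L2surf (g : R3 R -> R) : Prop :=
  measurable_fun Gam (g : caraR3 R -> R) /\
  (\int[surf R]_(x in Gam) (g x ^+ 2)%:E < +oo)%E.

Definition nL2surf (g : R3 R -> R) : R :=
  Num.sqrt (\int[surf R]_(x in Gam) (g x ^+ 2)).

Definition ae_on (S : set (R3 R)) (f g : R3 R -> R) : Prop :=
  \forall x \ae surf R, S x -> f x = g x.

(** [tr] is a trace operator for [Om], as provided by the trace theorem: a
    bounded linear map from [H1 Om] to [L2] of the boundary which restricts
    functions that are continuous up to the boundary. *)
Definition trace_operator (tr : (R3 R -> R) -> R3 R -> R) : Prop :=
  [/\ forall f, H1 f -> L2surf (tr f),
      forall (a : R) f g, H1 f -> H1 g ->
        ae_on Gam (tr (a *: f + g)) (a *: tr f + tr g),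
      exists C : R, forall f, H1 f -> nL2surf (tr f) <= C * nH1 f
    & forall f, H1 f -> {within closure Om, continuous f} ->
        ae_on Gam (tr f) f].

Section WithTrace.
Variable tr : (R3 R -> R) -> R3 R -> R.

Definition H10 : set (R3 R -> R) :=
  [set f | H1 f /\ ae_on Gam (tr f) (cst 0)].

(** H^{1/2}(S) is the space of traces on [S], with the quotient norm. *)
Definition nH12 (S : set (R3 R)) (g : R3 R -> R) : R :=
  inf [set nH1 f | f in [set f | H1 f /\ ae_on S (tr f) g]].

(** The real function [q] on [(0,T)], whose value [q t] is identified with the
    constant function [q t] on [S], belongs to H^1(0,T; H^{1/2}(S)). *)
Definition H1_time_H12 (S : set (R3 R)) (T : R) (q : R -> R) : Prop :=
  let L2_time (r : R -> R) :=
    measurable_fun `]0, T[ r /\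
    (\int[@lebesgue_measure R]_(t in `]0%R, T[) (nH12 S (cst (r t)) ^+ 2)%:E
       < +oo)%E in
  L2_time q /\
  exists2 dq : R -> R, L2_time dq &
    forall psi : R -> R,
      (forall k t, derivable (derive1n k psi) t 1) ->
      (exists K : set R,
        [/\ compact K, K `<=` `]0, T[ & forall t, ~ K t -> psi t = 0]) ->
      \int[@lebesgue_measure R]_(t in `]0%R, T[) (q t * derive1 psi t) =
      - \int[@lebesgue_measure R]_(t in `]0%R, T[) (dq t * psi t).

End WithTrace.

Section Families.
Variable V : lmodType R.
Implicit Types (H : set (R3 R -> V)) (N : (R3 R -> V) -> R).

Definition ae_eqOm (f g : R3 R -> V) : Prop :=
  \forall x \ae leb3 R, Om x -> f x = g x.

Definition spanm (v : nat -> R3 R -> V) (m : nat) : set (R3 R -> V) :=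
  [set f | exists c : 'I_m -> R, ae_eqOm f (\sum_(j < m) c j *: v j)].

Definition lin_indep (v : nat -> R3 R -> V) : Prop :=
  forall m (c : 'I_m -> R),
    ae_eqOm (\sum_(j < m) c j *: v j) 0 -> forall j, c j = 0.

Definition galerkin_family H N (v : nat -> R3 R -> V) : Prop :=
  [/\ forall j, H (v j), lin_indep v &
      forall f, H f -> forall eps : R, 0 < eps ->
        exists m, exists2 g, spanm v m g & N (f - g) < eps].

(** [C^k([0,oo); X)] for a space [X] normed by [N] *)

Definition time_continuous N (u : R -> R3 R -> V) : Prop :=
  forall t, 0 <= t ->
    N (u s - u t) @[s --> within [set s | 0 <= s] (nbhs t)] --> 0.

Definition time_derivative N (u du : R -> R3 R -> V) : Prop :=
  forall t, 0 <= t ->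
    N ((s - t)^-1 *: (u s - u t) - du t)
      @[s --> within [set s | 0 <= s /\ s != t] (nbhs t)] --> 0.

Definition C0_time (X : set (R3 R -> V)) N (u : R -> R3 R -> V) : Prop :=
  (forall t, 0 <= t -> X (u t)) /\ time_continuous N u.

(** [u] is in [C^2([0,oo); X)] with derivatives [du] and [ddu]. *)
Definition C2_time (X : set (R3 R -> V)) N (u du ddu : R -> R3 R -> V) : Prop :=
  [/\ C0_time X N u, C0_time X N du, C0_time X N ddu,
      time_derivative N u du & time_derivative N du ddu].

Definition orth_proj (ip : (R3 R -> V) -> (R3 R -> V) -> R)
    (X : set (R3 R -> V)) (f pf : R3 R -> V) : Prop :=
  X pf /\ forall g, X g -> ip (f - pf) g = 0.

End Families.

Definition app_mx p n (A : 'M[R]_(p, n)) (f : R3 R -> 'cV[R]_n) :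
  R3 R -> 'cV[R]_p := fun x => A *m f x.

Definition galerkin_approx (cE : 'M[R]_6) (e : 'M[R]_(3, 6)) (epsS : 'M[R]_3)
    (rho alpha beta : R) (u_0 u_1 : R3 R -> 'cV[R]_3)
    (chi : R3 R -> R) (phie : R -> R)
    (v : nat -> R3 R -> 'cV[R]_3) (w : nat -> R3 R -> R) (m : nat)
    (u du ddu : R -> R3 R -> 'cV[R]_3) (phi : R -> R3 R -> R) : Prop :=
  [/\ C2_time (spanm v m) nH1B u du ddu,
      C0_time (spanm w m) nH1 phi,
      forall t, 0 <= t -> forall f g, spanm v m f -> spanm w m g ->
        ipL2 (rho *: ddu t) f + alpha * ipL2 (rho *: du t) f
        + ipL2 (app_mx cE (Bw (u t))) (Bw f)
        + beta * ipL2 (app_mx cE (Bw (du t))) (Bw f)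
        + ipL2 (app_mx e^T (gradw (phi t))) (Bw f)
        + ipL2 (app_mx e (Bw (u t))) (gradw g)
        - ipL2 (app_mx epsS (gradw (phi t))) (gradw g)
        = - phie t * ipL2 (app_mx e^T (gradw chi)) (Bw f)
          + phie t * ipL2 (app_mx epsS (gradw chi)) (gradw g),
      orth_proj ipH1B (spanm v m) u_0 (u 0)
    & orth_proj (@ipL2 3) (spanm v m) u_1 (du 0)].

Definition bounded_domain : Prop :=
  [/\ Om !=set0, open Om, connected Om & bounded_set Om].

Definition has_area (S : set (R3 R)) : Prop :=
  measurable (S : set (caraR3 R)) /\
  (0 < surf R S)%E.

Definition boundary_partition (Ge Gg Gr : set (R3 R)) : Prop :=
  [/\ Ge `<=` Gam, Gg `<=` Gam, Ge `&` Gg = set0 & Gr = Gam `\` (Ge `|` Gg)] /\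
  [/\ Ge !=set0 /\ has_area Ge, Gg !=set0 /\ has_area Gg
    & Gr !=set0 /\ has_area Gr].

End Spaces.

Section Material.
Variable R : realType.

Definition sym_posdef n (A : 'M[R]_n) : Prop :=
  A^T = A /\ forall x : 'cV[R]_n, x != 0 -> 0 < dotv x (A *m x).

Definition elast_mx (c11 c12 c13 c33 c44 : R) : 'M[R]_6 :=
  mx_of_rows 6 6
    [:: [:: c11; c12; c13; 0; 0; 0];
        [:: c12; c11; c13; 0; 0; 0];
        [:: c13; c13; c33; 0; 0; 0];
        [:: 0; 0; 0; c44; 0; 0];
        [:: 0; 0; 0; 0; c44; 0];
        [:: 0; 0; 0; 0; 0; (c11 - c12) / 2] ].

Definition permit_mx (eps11 eps33 : R) : 'M[R]_3 :=
  mx_of_rows 3 3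
    [:: [:: eps11; 0; 0];
        [:: 0; eps11; 0];
        [:: 0; 0; eps33] ].

Definition piezo_mx (e15 e13 e33 : R) : 'M[R]_(3, 6) :=
  mx_of_rows 3 6
    [:: [:: 0; 0; 0; 0; e15; 0];
        [:: 0; 0; 0; e15; 0; 0];
        [:: e13; e13; e33; 0; 0; 0] ].

End Material.

(* Main.v *)
(** Expanding the Galerkin solution in the bases [v], [w] turns the problem into
    a linear system for the coefficients [a] of [u_m] and [b] of [phi_m], with
    Gram matrices as coefficients. For [t > t0] it is unforced, and [b] is a
    linear function of [a] because the Gram matrix of the gradients of the
    [w_j] is definite: a function of H^1_0 with zero gradient is constant on
    the connected [Om], and its trace vanishes on a set of positive area.
    Twice the energy [E = rho |u'|^2 + <c B u, B u> + <eps grad phi, grad phi>]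
    is then nonincreasing, and [V = E / alpha + rho <u', u> +
    alpha rho |u|^2 / 2 + beta <c B u, B u> / 2] is nonnegative with
    [V' <= - E]. Hence [E] tends to 0 and [V] converges; as [<u', u>] tends
    to 0 too, [|u|^2] converges, although rigid motions in [V_m] prevent [u]
    from decaying. *)
Require Import Defs.
From HB Require Import structures.
From mathcomp Require Import all_boot all_order all_algebra.
From mathcomp Require Import all_classical all_reals all_analysis.
From mathcomp Require Import measurable_realfun.
From mathcomp Require Import ring lra.

Set Implicit Arguments.
Unset Strict Implicit.
Unset Printing Implicit Defensive.

Import Order.TTheory GRing.Theory Num.Theory.
Import numFieldNormedType.Exports.

Local Open Scope classical_set_scope.
Local Open Scope ring_scope.

(** * Integrals and null sets *)

(** [wop] selects one distributional image among many, and elements of [spanm] are fixed only up to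
    null sets. So [Bw] and [gradw] act linearly on expansions only once distributional images are
    known to be unique almost everywhere. That fundamental lemma, and the fact that a zero gradient
    forces constancy, account for the boxes and bumps of the first half; both are obtained from
    tensor products of one-variable bumps, without mollification. The weight [1 / alpha] in [V] is
    forced. Testing the equation with [u] shows that the other terms of [V] have derivative [rho
    |u'|^2 - <c B u, B u> - <eps grad phi, grad phi>], whose kinetic term has the wrong sign; since
    [E' = - 2 alpha rho |u'|^2 - 2 beta <c B u', B u'>], the term [E / alpha] contributes the
    missing [- 2 rho |u'|^2]. By definition [phi_m] is merely continuous in time; the time
    derivative needed for [E'] is extracted from the static constraint. *)

Section AeIntegral.
Context d (T : measurableType d) (R : realType).
Variable mu : {measure set T -> \bar R}.
Local Open Scope ereal_scope.
Implicit Types (D : set T) (f g : T -> \bar R).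
Import HBNNSimple.

Lemma aeS (P Q : T -> Prop) : (forall x, P x -> Q x) ->
  (\forall x \ae mu, P x) -> \forall x \ae mu, Q x.
Proof. by move=> PQ; apply: filterS. Qed.

Lemma aeS2 (P Q S : T -> Prop) : (forall x, P x -> Q x -> S x) ->
  (\forall x \ae mu, P x) -> (\forall x \ae mu, Q x) -> \forall x \ae mu, S x.
Proof. by move=> PQ; apply: filterS2. Qed.

Lemma ae_forall_fin (I : finType) (P : I -> T -> Prop) :
  (forall i, \forall x \ae mu, P i x) -> \forall x \ae mu, forall i, P i x.
Proof. by move=> H; apply: filter_forall. Qed.

(* Neither [f] nor [g] is assumed measurable: the elements of [spanm] are only
   almost everywhere equal to measurable functions, and the product measure
   is not complete. *)
Lemma ae_ge0_le_integral D f g : (forall x, D x -> 0 <= f x) ->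
  (forall x, D x -> 0 <= g x) ->
  (\forall x \ae mu, D x -> f x <= g x) ->
  \int[mu]_(x in D) f x <= \int[mu]_(x in D) g x.
Proof.
move=> f0 g0 [N [mN N0 fgN]]; rewrite !ge0_integralE//.
apply: ge_ereal_sup => _ [h /= hf <-].
have mCN : measurable (~` N) by exact: measurableC.
(* Cutting the simple function off on the null set [N] keeps its integral and puts it below [g]
   everywhere. *)
pose h' := proj_nnsfun h mCN.
have -> : sintegral mu h = sintegral mu h'.
  have E (k : {nnsfun T >-> R}) : sintegral mu k = \int[mu]_x (k x)%:E.
    by rewrite integral_nnsfun// patch_setT.
  rewrite !E; apply: ae_eq_integral => //.
  - exact/measurable_EFinP.
  - exact/measurable_EFinP.
  exists N; split => // x /= xN; apply: contrapT => Nx; apply: xN => _.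
  by rewrite /= mindicE mem_set// mulr1.
apply: ereal_sup_ubound => /=; exists h' => // x; rewrite /= mindicE.
have [Nx|Nx] := pselect (N x).
  rewrite memNset//= mulr0 /patch; by case: ifPn => // /set_mem /g0.
rewrite mem_set// mulr1; apply: le_trans (hf x) _; rewrite /patch.
case: ifPn => // /set_mem Dx; apply: contrapT => H; apply: Nx; apply: fgN => /=.
by move=> /(_ Dx).
Qed.

Lemma ae_integral D f g :
  (\forall x \ae mu, D x -> f x = g x) ->
  \int[mu]_(x in D) f x = \int[mu]_(x in D) g x.
Proof.
move=> fg; rewrite integralE [RHS]integralE; congr (_ - _).
- apply/eqP; rewrite eq_le; apply/andP; split; apply: ae_ge0_le_integral => //.
  + by apply: filterS fg => x fg Dx; rewrite !funeposE fg.
  + by apply: filterS fg => x fg Dx; rewrite !funeposE fg.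
- apply/eqP; rewrite eq_le; apply/andP; split; apply: ae_ge0_le_integral => //.
  + by apply: filterS fg => x fg Dx; rewrite !funenegE fg.
  + by apply: filterS fg => x fg Dx; rewrite !funenegE fg.
Qed.

Lemma ae_Rintegral D (f g : T -> R) :
  (\forall x \ae mu, D x -> f x = g x) ->
  (\int[mu]_(x in D) f x = \int[mu]_(x in D) g x)%R.
Proof.
move=> fg; rewrite /Rintegral; congr fine; apply: ae_integral.
by apply: filterS fg => x fg Dx; rewrite fg.
Qed.

End AeIntegral.

(** * Boxes with rational corners *)

Section Boxes.
Variable R : realType.
Implicit Types (a b x y : R3 R) (U : set (R3 R)).

Definition obox a b : set (R3 R) :=
  [set x | [/\ a.1.1 < x.1.1 < b.1.1, a.1.2 < x.1.2 < b.1.2 & a.2 < x.2 < b.2]].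

Definition cbox a b : set (R3 R) :=
  [set x | [/\ a.1.1 <= x.1.1 <= b.1.1, a.1.2 <= x.1.2 <= b.1.2
             & a.2 <= x.2 <= b.2]].

Lemma oboxE a b : obox a b =
  (`]a.1.1, b.1.1[ `*` `]a.1.2, b.1.2[) `*` `]a.2, b.2[.
Proof.
by apply/seteqP; split => x /=; rewrite !in_itv/=; [case=> -> -> ->|case=> -[]].
Qed.

Lemma cboxE a b : cbox a b =
  (`[a.1.1, b.1.1] `*` `[a.1.2, b.1.2]) `*` `[a.2, b.2].
Proof.
by apply/seteqP; split => x /=; rewrite !in_itv/=; [case=> -> -> ->|case=> -[]].
Qed.

Lemma obox_cbox a b : obox a b `<=` cbox a b.
Proof.
by move=> x [/andP[? ?] /andP[? ?] /andP[? ?]]; split; apply/andP; split;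
  exact: ltW.
Qed.

Definition maxpt a b : R3 R :=
  (Num.max a.1.1 b.1.1, Num.max a.1.2 b.1.2, Num.max a.2 b.2).

Definition minpt a b : R3 R :=
  (Num.min a.1.1 b.1.1, Num.min a.1.2 b.1.2, Num.min a.2 b.2).

Lemma oboxI p q a b : obox p q `&` obox a b = obox (maxpt p a) (minpt q b).
Proof.
apply/seteqP; split => x; rewrite /obox/= !gt_max !lt_min.
  by move=> [[/andP[-> ->] /andP[-> ->] /andP[-> ->]]
    [/andP[-> ->] /andP[-> ->] /andP[-> ->]]].
by move=> [/andP[/andP[-> ->] /andP[-> ->]] /andP[/andP[-> ->] /andP[-> ->]]
  /andP[/andP[-> ->] /andP[-> ->]]].
Qed.

Lemma compact_cbox a b : compact (cbox a b).
Proof.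
by rewrite cboxE; do 2 ?apply: compact_setX; exact: segment_compact.
Qed.

Lemma measurable_obox a b : measurable (obox a b : set (mR3 R)).
Proof.
rewrite oboxE; apply: measurableX; first exact: measurableX.
exact: measurable_itv.
Qed.

Definition ratpt (q : rat * rat * rat) : R3 R :=
  (ratr q.1.1, ratr q.1.2, ratr q.2).

(** Rational corners make the family countable; the closed box stays inside [U] so that it can carry
    the support of a test function. *)
Lemma open_box U x : open U -> U x ->
  exists p q, obox (ratpt p) (ratpt q) x /\ cbox (ratpt p) (ratpt q) `<=` U.
Proof.
move=> oU Ux; have /nbhs_ballP[e /= e0 xeU] : nbhs x U by exact: open_nbhs_nbhs.
have H (t : R) : exists p q : rat,
    t - e < ratr p /\ ratr p < t < ratr q /\ ratr q < t + e.
  have [p] : exists q : rat, ratr q \in `]t - e, t[.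
    by apply: rat_in_itvoo; rewrite ltrBlDr ltrDl.
  have [q] : exists q : rat, ratr q \in `]t, t + e[.
    by apply: rat_in_itvoo; rewrite ltrDl.
  rewrite !in_itv/= => /andP[tq qe] /andP[ep pt].
  by exists p, q; rewrite pt tq.
have [p1 [q1 [h1 [h2 h3]]]] := H x.1.1.
have [p2 [q2 [k1 [k2 k3]]]] := H x.1.2.
have [p3 [q3 [l1 [l2 l3]]]] := H x.2.
exists (p1, p2, p3), (q1, q2, q3); split => //.
move=> y [/= /andP[? ?] /andP[? ?] /andP[? ?]].
apply: xeU; split; first split.
- rewrite /ball/= ltr_distlC; apply/andP; split.
    exact: lt_le_trans h1 _.
  exact: le_lt_trans h3.
- rewrite /ball/= ltr_distlC; apply/andP; split.
    exact: lt_le_trans k1 _.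
  exact: le_lt_trans k3.
- rewrite /ball/= ltr_distlC; apply/andP; split.
    exact: lt_le_trans l1 _.
  exact: le_lt_trans l3.
Qed.

(** The topology of [R3 R] and the product sigma-algebra of [mR3 R] are set up independently; they
    meet because an open set is a countable union of rational open boxes. *)
Lemma open_measurable3 U : open U -> measurable (U : set (mR3 R)).
Proof.
move=> oU.
pose F (i : (rat * rat * rat) * (rat * rat * rat)) : set (mR3 R) :=
  if `[< cbox (ratpt i.1) (ratpt i.2) `<=` U >]
  then obox (ratpt i.1) (ratpt i.2) else set0.
have -> : U = \bigcup_i F i.
  apply/seteqP; split => [x Ux|x [i _]]; last first.
    by rewrite /F; case: asboolP => // + /obox_cbox; exact.
  have [p [q [pqx pqU]]] := open_box oU Ux.
  by exists (p, q) => //; rewrite /F; case: asboolP.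
apply: countable_bigcupT_measurable; first exact: countableP.
by move=> i; rewrite /F; case: asboolP => _ //; exact: measurable_obox.
Qed.

Lemma continuous_measurable3 (f : R3 R -> R) : continuous f ->
  measurable_fun (setT : set (mR3 R)) f.
Proof.
move=> cf _; apply: (measurability _ (RGenOpens.measurableE R)) => //.
move=> _ [_ [a [b ->] <-]]; rewrite setTI.
by apply: open_measurable3; apply: open_comp => // x _; exact: cf.
Qed.

(** The rational boxes whose closure lies in [U] already cover it, so countably many exceptional
    sets are united into a null set. *)
Lemma ae_from_boxes U (P : R3 R -> Prop) : open U ->
  (forall a b, cbox a b `<=` U -> \forall x \ae leb3 R, obox a b x -> P x) ->
  \forall x \ae leb3 R, U x -> P x.
Proof.
move=> oU bP.
pose T := ((rat * rat * rat) * (rat * rat * rat))%type.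
pose G (i : T) : set (mR3 R) :=
  if `[< cbox (ratpt i.1) (ratpt i.2) `<=` U >]
  then [set x | obox (ratpt i.1) (ratpt i.2) x /\ ~ P x] else set0.
pose F (n : nat) : set (mR3 R) := if @unpickle T n is Some i then G i else set0.
have : (leb3 R).-negligible (\bigcup_i F i).
  apply: negligible_bigcup => i; rewrite /F; case: (unpickle i) => [[p q]|];
    last first.
    exact: negligible_set0.
  rewrite /G; case: asboolP => [pqU|_]; last exact: negligible_set0.
  have := bP _ _ pqU; apply: negligibleS => x /= [xpq nP] H.
  exact/nP/H.
apply: negligibleS => x /= H.
have [Ux nP] : U x /\ ~ P x by split; [apply: contrapT => nU;
  apply: H => /nU|move=> Px; apply: H].
have [p [q [pqx pqU]]] := open_box oU Ux.
exists (@pickle T (p, q)); first exact: I.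
suff : G (p, q) x by rewrite /F pickleK.
by rewrite /G; case: asboolP => [_|/(_ pqU)//]; split.
Qed.

End Boxes.

(** * Smooth bump functions *)

Section Smooth1.
Variable R : realType.
Implicit Types (f g : R -> R) (x : R) (P : {poly R}).

Definition smooth1 f := forall k x, derivable (derive1n k f) x 1.

(** Derivatives are peeled off from the inside, so that closure under sums and products is an
    induction on [k] through the Leibniz rule. Note the shift: [Cn k] asks for [k + 1]
    derivatives. *)
Fixpoint Cn k f : Prop :=
  (forall x, derivable f x 1) /\ if k is k'.+1 then Cn k' (derive1 f) else True.

Lemma smooth1P f : smooth1 f <-> forall k, Cn k f.
Proof.
split=> [sf k|cf k x].
  elim: k f sf => [|k ih] f sf /=; first by split=> // x; exact: (sf 0%N).
  split; first by move=> x; exact: (sf 0%N).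
  by apply: ih => j x; rewrite -derive1Sn; exact: sf.
elim: k f cf => [|k ih] f cf; first by have [+ _] := cf 0%N; apply.
by rewrite derive1Sn; apply: ih => j; have [] := cf j.+1.
Qed.

Lemma CnS k f : Cn k.+1 f -> Cn k f.
Proof.
elim: k f => [|k ih] f [df H]; first by split.
by split => //; exact: ih.
Qed.

Lemma Cn_derivable k f : Cn k f -> forall x, derivable f x 1.
Proof. by case: k => [|k] []. Qed.

Lemma derive1D f g : (forall x, derivable f x 1) -> (forall x, derivable g x 1) ->
  derive1 (f \+ g) = derive1 f \+ derive1 g.
Proof.
move=> df dg; apply/funext => x; rewrite /= !derive1E.
exact: deriveD.
Qed.

Lemma derive1M f g : (forall x, derivable f x 1) -> (forall x, derivable g x 1) ->
  derive1 (f \* g) = (derive1 f \* g) \+ (f \* derive1 g).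
Proof.
move=> df dg; apply/funext => x; rewrite /= !derive1E.
rewrite (_ : f \* g = f * g)// deriveM//.
by rewrite addrC /GRing.scale/= mulrC.
Qed.

Lemma CnD k f g : Cn k f -> Cn k g -> Cn k (f \+ g).
Proof.
elim: k f g => [|k ih] f g [df cf] [dg cg].
  by split => // x; exact: derivableD.
split; first by move=> x; exact: derivableD.
by rewrite derive1D//; exact: ih.
Qed.

Lemma CnM k f g : Cn k f -> Cn k g -> Cn k (f \* g).
Proof.
elim: k f g => [|k ih] f g cf cg.
  by split => // x; apply: derivableM; [case: cf|case: cg].
have df := Cn_derivable cf. have dg := Cn_derivable cg.
split; first by move=> x; exact: derivableM.
rewrite derive1M//; apply: CnD; apply: ih.
- by case: cf.
- exact: CnS.
- exact: CnS.
- by case: cg.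
Qed.

Lemma derive1_affine f (a b : R) : (forall x, derivable f x 1) ->
  forall x, is_derive x 1 (fun y => f (a * y + b)) (a * (derive1 f) (a * x + b)).
Proof.
move=> df x; rewrite mulrC.
apply: (@is_derive1_comp _ f (fun y => a * y + b)).
  by rewrite derive1E; exact: derivableP.
have -> : (fun y => a * y + b) = (a *: id) + cst b by apply/funext.
have H : is_derive x 1 (a *: id + cst b) (a *: (1 : R) + 0) by exact: is_deriveD.
by apply: is_derive_eq; rewrite addr0 /GRing.scale/= mulr1.
Qed.

Lemma Cn_cst k (c : R) : Cn k (cst c).
Proof.
elim: k c => [|k ih] c; first by split => // x.
split; first by move=> x.
have -> : derive1 (cst c) = cst 0 by apply/funext => x; rewrite derive1_cst.
exact: ih.
Qed.

Lemma Cn_affine k f (a b : R) : Cn k f -> Cn k (fun x => f (a * x + b)).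
Proof.
elim: k f => [|k ih] f cf.
  by split => // x; have [] := derive1_affine a b (Cn_derivable cf) x.
split.
  by move=> x; have [] := derive1_affine a b (Cn_derivable cf) x.
have -> : derive1 (fun x => f (a * x + b)) = (cst a) \* (fun x =>
  derive1 f (a * x + b)).
  apply/funext => x; rewrite derive1E /=.
  by have := derive1_affine a b (Cn_derivable cf) x => /@derive_val ->.
by apply: CnM; [exact: Cn_cst|apply: ih; case: cf].
Qed.

Lemma is_derive_horner P x : is_derive x 1 (horner P) (P^`().[x]).
Proof.
elim/poly_ind: P => [|p c ih].
  have -> : horner 0 = cst (0 : R) by apply/funext => y; rewrite horner0.
  by rewrite deriv0 horner0; exact: is_derive_cst.
rewrite (_ : horner (p * 'X + c%:P) = (horner p * id) + cst c); last first.
  by apply/funext => y; rewrite hornerMXaddC.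
rewrite derivMXaddC hornerD hornerMX.
have H : is_derive x 1 (horner p * id + cst c) (p.[x] *: (1 : R) + x *:
  p^`().[x] + 0).
  by apply: is_deriveD; exact: is_deriveM.
by apply: is_derive_eq; rewrite addr0 /GRing.scale/= mulr1 [x * _]mulrC.
Qed.

(** Termwise from [y ^ i <= i! exp y], whence the factorials in the constant. *)
Lemma poly_le_expR P : exists2 C, 0 <= C & forall y, 0 <= y ->
  `|P.[y]| <= C * expR y.
Proof.
exists (\sum_(i < size P) `|P`_i| * i`!%:R).
  by apply: sumr_ge0 => i _; rewrite mulr_ge0.
move=> y y0; rewrite horner_coef mulr_suml.
apply: le_trans (ler_norm_sum _ _ _) _; apply: ler_sum => i _.
rewrite normrM -mulrA ler_wpM2l// ger0_norm ?exprn_ge0//.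
case: (nat_of_ord i) => [|n].
  by rewrite expr0 fact0 mul1r -expR0 ler_expR.
have := expR_ge1Dxn n y0; rewrite -ler_pdivrMl ?ltr0n ?fact_gt0//.
by apply: le_trans; rewrite mulrC lerDr.
Qed.

(* The class of these functions is closed under derivation, which is how
   [exp (-1/x)] is seen to be smooth at [0]. *)
Definition flat P x : R := if 0 < x then P.[x^-1] * expR (- x^-1) else 0.

(** With [y = 1 / x], differentiating [P(y) exp (- y)] gives [- y^2 (P'(y) - P(y)) exp (- y)], again
    of the same shape. The only delicate point is [0]. *)
Lemma is_derive_flat P x : is_derive x 1 (flat P) (flat ('X^2 * (P - P^`())) x).
Proof.
have [x0|x0|->] := ltgtP x 0.
- rewrite [X in is_derive _ _ _ X](_ : _ = 0); last first.
    by rewrite /flat ltNge ltW.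
  apply: (@near_eq_is_derive _ _ _ (cst 0)).
  near=> y; rewrite /flat ltNge ltW//.
  by near: y; exact: lt_nbhsl.
- rewrite {2}/flat x0.
  apply: (@near_eq_is_derive _ _ _ (fun y : R => P.[y^-1] * expR (- y^-1))).
    by near=> y; rewrite /flat ifT//; near: y; exact: lt_nbhsr.
  have dV : is_derive x 1 (fun y : R => y^-1) (- x ^- 2).
    apply: is_derive_eq; first by apply: is_deriveV; rewrite gt_eqF.
    by rewrite /GRing.scale/= mulr1.
  have d1 : is_derive x 1 (horner P \o (fun y : R =>
    y^-1)) (P^`().[x^-1] * - x ^- 2).
    by apply: is_derive1_comp; exact: is_derive_horner.
  have d2 : is_derive x 1 (expR \o (fun y : R =>
    - y^-1)) (expR (- x^-1) * - - x ^- 2).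
    by apply: is_derive1_comp.
  have := is_deriveM d1 d2.
  rewrite [X in is_derive _ _ X _ -> _](_ : _ = (fun y : R =>
    P.[y^-1] * expR (- y^-1)))// => d3.
  apply: (is_derive_eq d3).
  rewrite /GRing.scale/= hornerM hornerXn hornerD hornerN !opprK.
  by rewrite exprVn; ring.
- rewrite {2}/flat ltxx.
  (* Of the two extra powers of [1 / h], one pays for the division in the difference quotient and
     the other leaves the bound [C h]. *)
  have [C C0 HC] := poly_le_expR (P * 'X^2).
  suff H : h^-1 *: (flat P (h *: 1 + 0) - flat P 0) @[h --> 0^'] --> (0:R).
    by apply: DeriveDef; [apply/cvg_ex; exists 0|exact/cvg_lim].
  apply/cvgr0Pnorm_le => e e0; near=> h.
  rewrite addr0 /flat ltxx subr0 /GRing.scale/= mulr1.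
  case: ifPn => h0; last by rewrite mulr0 normr0 ltW.
  have hV0 : 0 <= h^-1 by rewrite invr_ge0 ltW.
  have := HC _ hV0; rewrite hornerM hornerXn -ler_pdivrMr ?expR_gt0//.
  rewrite -expRN -[X in _ * X <= _]ger0_norm ?expR_ge0// -normrM => H.
  have : `|h^-1 * (P.[h^-1] * expR (- h^-1))| <= C * h.
    rewrite -ler_pdivrMr//; apply: le_trans H.
    rewrite -[X in _ / X](ger0_norm (ltW h0)) -normfV -normrM.
    by rewrite le_eqVlt; apply/orP; left; apply/eqP; congr `|_|; ring.
  move/le_trans; apply.
  rewrite -[h](ger0_norm (ltW h0)).
  (* [C] may be 0, and the neighbourhood is chosen by dividing by the constant. *)
  apply: (@le_trans _ _ ((C + 1) * `|h|)); first by rewrite ler_wpM2r// lerDl.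
  rewrite mulrC -ler_pdivlMr ?ltr_wpDl//.
  by near: h; apply: dnbhs0_le; rewrite divr_gt0// ltr_wpDl.
Unshelve. all: by end_near. Qed.

Lemma Cn_flat k P : Cn k (flat P).
Proof.
elim: k P => [|k ih] P.
  by split => // x; have [] := is_derive_flat P x.
split; first by move=> x; have [] := is_derive_flat P x.
rewrite (_ : derive1 (flat P) = flat ('X^2 * (P - P^`())))//.
by apply/funext => x; rewrite derive1E; have := is_derive_flat P x =>
  /@derive_val ->.
Qed.

End Smooth1.

Section Bump.
Variable R : realType.
Implicit Types (f g : R -> R) (p q x : R).

(* [exp (-1/(n(x-p)) - 1/(n(q-x)))]: bumps that converge to the indicator of
   [p, q] without any normalizing quotient. *)
Definition bump n p q x : R :=
  flat 1 (n.+1%:R * (x - p)) * flat 1 (n.+1%:R * (q - x)).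

Lemma smooth1_bump n p q : smooth1 (bump n p q).
Proof.
pose N : R := n.+1%:R.
rewrite (_ : bump n p q = (fun x => flat 1 (N * x + - (N * p))) \*
    (fun x => flat 1 (- N * x + N * q))).
  by apply/smooth1P => k; apply: CnM; apply: Cn_affine; exact: Cn_flat.
by apply/funext => x; rewrite /bump/=; congr (flat _ _ * flat _ _); rewrite /N;
  ring.
Qed.

Lemma flat1_itv x : 0 <= flat 1 x <= (1 : R).
Proof.
rewrite /flat; case: ifPn => x0; last by rewrite lexx ler01.
by rewrite hornerC mul1r expR_ge0 expR_le1 oppr_le0 invr_ge0 ltW.
Qed.

Lemma bump_itv n p q x : 0 <= bump n p q x <= 1.
Proof.
have /andP[a0 a1] := flat1_itv (n.+1%:R * (x - p)).
have /andP[b0 b1] := flat1_itv (n.+1%:R * (q - x)).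
by rewrite /bump mulr_ge0//= mulr_ile1.
Qed.

Lemma bump0 n p q x : x \notin `]p, q[ -> bump n p q x = 0.
Proof.
rewrite in_itv/= negb_and -!leNgt /bump /flat => /orP[xp|qx].
  by rewrite pmulr_rgt0// subr_gt0 ltNge xp/= mul0r.
by rewrite mulrC pmulr_rgt0// subr_gt0 ltNge qx/= mul0r.
Qed.

(** Inside the interval each factor is [exp (- 1 / ((n + 1) d))] with [d > 0] the distance to an
    endpoint; at the endpoints and outside the bumps vanish, so the convergence holds at every
    point. *)
Lemma cvg_bump p q x : bump n p q x @[n --> \oo] --> (\1_(`]p,
  q[%classic : set R) x : R).
Proof.
rewrite indicE; have [|/negP nx] := boolP (x \in _); last first.
  rewrite (_ : (fun n => _) = cst 0); first exact: cvg_cst.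
  by apply/funext => n; apply: bump0; apply/negP => h; apply: nx; rewrite inE.
rewrite inE/= in_itv/= => /andP[px xq].
have H (d : R) : 0 < d -> flat 1 (n.+1%:R * d) @[n --> \oo] --> (1 : R).
  move=> d0; rewrite (_ : (fun n => _) = (fun n : nat =>
    expR (- (d^-1 * n.+1%:R^-1)))); last first.
    by apply/funext => n; rewrite /flat pmulr_rgt0// d0 hornerC mul1r invfM mulrC.
  rewrite -[X in _ --> X]expR0; apply: continuous_cvg; first exact: continuous_expR.
  rewrite -[X in _ --> X]oppr0; apply: cvgN.
  rewrite -[X in _ --> X](mulr0 d^-1); apply: cvgM; first exact: cvg_cst.
  exact: cvg_harmonic.
rewrite -[X in _ --> X](mulr1 1); apply: cvgM.
  by apply: H; rewrite subr_gt0.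
by apply: H; rewrite subr_gt0.
Qed.

End Bump.

(** * Test functions with separated variables *)

Section Tensor.
Variable R : realType.
Implicit Types (a b c : R -> R) (x p q : R3 R).

Definition tens a b c x : R := a x.1.1 * b x.1.2 * c x.2.

Let i0 : 'I_3 := @Ordinal 3 0 isT.
Let i1 : 'I_3 := @Ordinal 3 1 isT.
Let i2 : 'I_3 := @Ordinal 3 2 isT.

Definition dtens (i : 'I_3) a b c : R3 R -> R :=
  match val i with
  | 0%N => tens (derive1 a) b c | 1%N => tens a (derive1 b) c
  | _ => tens a b (derive1 c)
  end.

Lemma is_derive_tens (i : 'I_3) a b c x :
  (forall t, derivable a t 1) -> (forall t, derivable b t 1) ->
  (forall t, derivable c t 1) ->
  is_derive x (edir R i) (tens a b c) (dtens i a b c x).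
Proof.
move=> da db dc.
have D (f : R -> R) (t : R) : (forall t, derivable f t 1) ->
    h^-1 * (f (h + t) - f t) @[h --> 0^'] --> derive1 f t.
  move=> /(_ t) df; rewrite derive1E.
  rewrite (_ : (fun h => _) = (fun h => h^-1 *: (f (h *: 1 + t) - f t)));
    first exact: df.
  by apply/funext => h; rewrite /GRing.scale/= mulr1.
suff H : h^-1 *: (tens a b c (h *: edir R i + x) - tens a b c x) @[h --> 0^'] -->
    dtens i a b c x.
  by apply: DeriveDef; [apply/cvg_ex; eexists; exact: H|exact/cvg_lim].
case: x => -[x y] z; case: i => -[|[|[|//]]] ilt; rewrite /dtens /tens/=.
- rewrite (_ : (fun h => _) = (fun h => h^-1 * (a (h + x) - a x) * b y * c z)).
    by apply: cvgM; [apply: cvgM; [exact: D|exact: cvg_cst]|exact: cvg_cst].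
  apply/funext => h; rewrite /GRing.scale/= !mulr1 !mulr0 !add0r; ring.
- rewrite (_ : (fun h => _) = (fun h => a x * (h^-1 * (b (h + y) - b y)) * c z)).
    by apply: cvgM; [apply: cvgM; [exact: cvg_cst|exact: D]|exact: cvg_cst].
  apply/funext => h; rewrite /GRing.scale/= !mulr1 !mulr0 !add0r; ring.
- rewrite (_ : (fun h => _) = (fun h => a x * b y * (h^-1 * (c (h + z) - c z)))).
    by apply: cvgM; [exact: cvg_cst|exact: D].
  apply/funext => h; rewrite /GRing.scale/= !mulr1 !mulr0 !add0r; ring.
Qed.

Lemma continuous_tens a b c : continuous a -> continuous b -> continuous c ->
  continuous (tens a b c).
Proof.
move=> ca cb cc x; apply: cvgM; first apply: cvgM.
- apply: continuous_comp; last exact: ca.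
  by apply: continuous_comp; [exact: cvg_fst|exact: cvg_fst].
- apply: continuous_comp; last exact: cb.
  by apply: continuous_comp; [exact: cvg_fst|exact: cvg_snd].
- by apply: continuous_comp; [exact: cvg_snd|exact: cc].
Qed.

Lemma smooth1_derivable a : smooth1 a -> forall t, derivable a t 1.
Proof. by move=> /(_ 0%N). Qed.

Lemma smooth1_derive1 a : smooth1 a -> smooth1 (derive1 a).
Proof. by move=> sa k t; rewrite -derive1Sn; exact: sa. Qed.

Lemma smooth1_continuous a : smooth1 a -> continuous a.
Proof.
move=> sa t; apply/differentiable_continuous/derivable1_diffP.
exact: smooth1_derivable.
Qed.

Lemma derive_tens (i : 'I_3) a b c : smooth1 a -> smooth1 b -> smooth1 c ->
  'D_(edir R i) (tens a b c) = dtens i a b c.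
Proof.
move=> sa sb sc; apply/funext => x.
by have [_ ->] := is_derive_tens i x (smooth1_derivable sa)
  (smooth1_derivable sb) (smooth1_derivable sc).
Qed.

Lemma smooth_tens a b c : smooth1 a -> smooth1 b -> smooth1 c ->
  smooth (tens a b c).
Proof.
move=> sa sb sc s.
suff [a' [b' [c' [sa' sb' sc' ->]]]] : exists a' b' c',
    [/\ smooth1 a', smooth1 b', smooth1 c' &
     foldr (fun i (f : R3 R -> R) => 'D_(edir R i) f) (tens a b c) s = tens a'
       b' c'].
  split; first by apply: continuous_tens; exact: smooth1_continuous.
  move=> i x; by have [] := is_derive_tens i x (smooth1_derivable sa')
    (smooth1_derivable sb') (smooth1_derivable sc').
elim: s => [|i s [a' [b' [c' [sa' sb' sc' /= ->]]]]]; first by exists a, b, c.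
rewrite derive_tens//; case: i => -[|[|[|//]]] ilt; rewrite /dtens/=.
- by exists (derive1 a'), b', c'; split; [exact: smooth1_derive1|exact:
  sb'|exact: sc'|].
- by exists a', (derive1 b'), c'; split; [exact: sa'|exact:
  smooth1_derive1|exact: sc'|].
- by exists a', b', (derive1 c'); split; [exact: sa'|exact: sb'|exact:
  smooth1_derive1|].
Qed.

Lemma test_fun_tens (Om : set (R3 R)) p q a b c :
  smooth1 a -> smooth1 b -> smooth1 c -> cbox p q `<=` Om ->
  (forall t, t \notin `[p.1.1, q.1.1] -> a t = 0) ->
  (forall t, t \notin `[p.1.2, q.1.2] -> b t = 0) ->
  (forall t, t \notin `[p.2, q.2] -> c t = 0) ->
  test_fun Om (tens a b c).
Proof.
move=> sa sb sc pqOm a0 b0 c0; split; first exact: smooth_tens.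
exists (cbox p q); split => //; first exact: compact_cbox.
move=> x; rewrite cboxE => xpq; rewrite /tens.
have [xa|/a0->] := boolP (x.1.1 \in `[p.1.1, q.1.1]); last by rewrite !mul0r.
have [xb|/b0->] := boolP (x.1.2 \in `[p.1.2, q.1.2]); last by rewrite mulr0 mul0r.
have [xc|/c0->] := boolP (x.2 \in `[p.2, q.2]); last by rewrite mulr0.
by case: xpq; split.
Qed.

End Tensor.

(** * Functions determined by their integrals over boxes *)

Section Integral0.
Context (R : realType) d (T : measurableType d) (mu : {measure set T -> \bar R}).
Variable f : T -> \bar R.

(** The sets over whose preimage the integral vanishes form a Dynkin system. Stating this for
    preimages under [h] allows one coordinate to be treated at a time. *)
Lemma integral0_preimage d' (T' : measurableType d') (G : set (set T'))
    (D : set T) (h : T -> T') :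
  measurable = <<s G >> -> setI_closed G -> measurable D ->
  mu.-integrable D f -> measurable_fun setT h ->
  (\int[mu]_(x in D) f x = 0)%E ->
  (forall A, G A -> (\int[mu]_(x in D `&` h @^-1` A) f x = 0)%E) ->
  forall A, measurable A -> (\int[mu]_(x in D `&` h @^-1` A) f x = 0)%E.
Proof.
move=> sG IG mD fi mh f0 fG.
have mhA A : measurable A -> measurable (D `&` h @^-1` A).
  by move=> mA; apply: measurableI => //; rewrite -[X in measurable X]setTI;
    exact: mh.
move=> A; rewrite sG.
pose P (A : set T') := (\int[mu]_(x in D `&` h @^-1` A) f x = 0)%E.
apply: (@dynkin_induction _ _ G P sG IG) => //.
- by rewrite /P preimage_setT setIT.
- move=> S mS; rewrite /P => S0.
  have mS' := measurableC mS.
  have DE : D = (D `&` h @^-1` S) `|` (D `&` h @^-1` (~` S)).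
    by rewrite -setIUr preimage_setC setUv setIT.
  move: f0; rewrite {1}DE integral_setU; last 4 first.
  - exact: mhA.
  - exact: mhA.
  - by rewrite -DE; exact: measurable_int fi.
  - by apply/disj_setPS => x [[_ ?] [_ ?]].
  by rewrite S0 add0e.
- move=> F mF tF F0; rewrite /P preimage_bigcup setI_bigcupr integral_bigcup//.
  + by apply: eseries0 => i _ _; exact: F0.
  + apply/trivIsetP => i j _ _ ij; apply/seteqP; split => // x [[_ xi] [_ xj]].
    have /seteqP[H _] := trivIsetP.1 tF i j I I ij.
    by case: (H (h x)); split.
  + by move=> k; exact: mhA.
  + rewrite -setI_bigcupr; apply: integrableS fi => //.
    by apply: measurableI => //; apply: bigcup_measurable => k _;
      rewrite -[X in measurable X]setTI; exact: mh.
Qed.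

End Integral0.

Section BoxZero.
Variable R : realType.
Local Notation mu := (leb3 R).

Lemma setI_closed_RGenOpens : setI_closed (@RGenOpens.G R).
Proof.
move=> _ _ [a [b ->]] [c [e ->]].
exists (Num.max a c), (Num.min b e); apply/seteqP; split => x /=; rewrite !in_itv/=.
  by move=> [/andP[? ?] /andP[? ?]]; rewrite gt_max lt_min; apply/andP; split;
    apply/andP.
by rewrite gt_max lt_min => /andP[/andP[-> ->] /andP[-> ->]].
Qed.

Lemma setI_closed_rectangle d1 d2 (T1 : measurableType d1) (T2 : measurableType
  d2) :
  setI_closed [set A `*` B | A in (measurable : set (set T1)) & B in
    (measurable : set (set T2))].
Proof.
move=> _ _ [A mA [B mB <-]] [A' mA' [B' mB' <-]].
exists (A `&` A'); first exact: measurableI.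
by exists (B `&` B'); [exact: measurableI|rewrite setXI].
Qed.

(** The vanishing is extended from open boxes to measurable rectangles side by side, then to all
    measurable subsets of the box. *)
Lemma ae0_of_integral_box (f : mR3 R -> \bar R) p q :
  mu.-integrable (obox p q) f ->
  (forall a b, \int[mu]_(x in obox p q `&` obox a b) f x = 0)%E ->
  \forall x \ae mu, obox p q x -> f x = 0%E.
Proof.
move=> fi f0; pose Q : set (mR3 R) := obox p q.
have mQ : measurable Q by exact: measurable_obox.
have sub (D : set (mR3 R)) : measurable D -> mu.-integrable (Q `&` D) f.
  by move=> mD; apply: integrableS fi => //; exact: measurableI.
pose X (x : mR3 R) : measurableTypeR R := x.1.1.
pose Y (x : mR3 R) : measurableTypeR R := x.1.2.
pose Z (x : mR3 R) : measurableTypeR R := x.2.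
have mX : measurable_fun setT X by exact: measurableT_comp.
have mY : measurable_fun setT Y by exact: measurableT_comp.
have mZ : measurable_fun setT Z by exact: measurable_snd.
have pX A : measurable A -> measurable (X @^-1` A).
  by move=> mA; rewrite -[Y in measurable Y]setTI; exact: mX.
have pY A : measurable A -> measurable (Y @^-1` A).
  by move=> mA; rewrite -[Y in measurable Y]setTI; exact: mY.
have pZ A : measurable A -> measurable (Z @^-1` A).
  by move=> mA; rewrite -[Y in measurable Y]setTI; exact: mZ.
pose I1 := `]p.1.1, q.1.1[%classic : set (measurableTypeR R).
pose I2 := `]p.1.2, q.1.2[%classic : set (measurableTypeR R).
pose I3 := `]p.2, q.2[%classic : set (measurableTypeR R).
(* [setT] is not a bounded open interval, hence not in the generating class; inside [Q] it may be
   traded for the side [I1], [I2] or [I3], which is. *)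
have QE A B C : Q `&` (X @^-1` A `&` Y @^-1` B `&` Z @^-1` C) =
   Q `&` (X @^-1` (A `&` I1) `&` Y @^-1` (B `&` I2) `&` Z @^-1` (C `&` I3)).
  apply/seteqP; split => x [Qx] [[xA xB] xC].
    by move: (Qx); rewrite /Q oboxE => -[[x1 x2] x3]; do !split.
  by case: xA => ? _; case: xB => ? _; case: xC => ? _; split => //;
    split => //; split.
have sG := RGenOpens.measurableE R.
have iG := setI_closed_RGenOpens.
have ooI (a b : R) : exists c e, `]a, b[%classic `&` I1 = `]c, e[%classic.
  by apply: iG; [exists a, b|exists p.1.1, q.1.1].
have moo (a b : R) : measurable (`]a, b[%classic : set (measurableTypeR R)).
  exact: measurable_itv.
have H0 A B C : @RGenOpens.G R A -> @RGenOpens.G R B -> @RGenOpens.G R C ->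
   (\int[mu]_(x in Q `&` (X @^-1` A `&` Y @^-1` B `&` Z @^-1` C)) f x = 0)%E.
  move=> [a1 [b1 ->]] [a2 [b2 ->]] [a3 [b3 ->]].
  have := f0 (a1, a2, a3) (b1, b2, b3).
  rewrite (_ : obox _ _ `&` _ = Q `&` (X @^-1` `]a1,
    b1[%classic `&` Y @^-1` `]a2, b2[%classic `&` Z @^-1` `]a3, b3[%classic))//.
  by rewrite (oboxE (a1, a2, a3)).
have GI1 : @RGenOpens.G R I1 by exists p.1.1, q.1.1.
have GI2 : @RGenOpens.G R I2 by exists p.1.2, q.1.2.
have GI3 : @RGenOpens.G R I3 by exists p.2, q.2.
have mG A : @RGenOpens.G R A -> measurable (A : set (measurableTypeR R)).
  by move=> [a [b ->]].
have H1 A B C : measurable A -> @RGenOpens.G R B -> @RGenOpens.G R C ->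
   (\int[mu]_(x in Q `&` (X @^-1` A `&` Y @^-1` B `&` Z @^-1` C)) f x = 0)%E.
  move=> mA GB GC.
  have E A' : Q `&` (X @^-1` A' `&` Y @^-1` B `&` Z @^-1` C) =
      (Q `&` (Y @^-1` B `&` Z @^-1` C)) `&` X @^-1` A'.
    by rewrite -!setIA; congr (_ `&` _); rewrite setIC -!setIA.
  rewrite E; apply: (integral0_preimage sG iG) => //.
  - by apply: measurableI => //; apply: measurableI; [apply: pY;
    exact: mG|apply: pZ; exact: mG].
  - by apply: sub; apply: measurableI; [apply: pY; exact: mG|apply: pZ; exact: mG].
  - rewrite (_ : _ `&` _ = Q `&` (X @^-1` setT `&` Y @^-1` B `&` Z @^-1` C));
    last first.
      by rewrite preimage_setT setTI.
    rewrite QE setTI -(setIid I1) -QE; exact: H0.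
  - by move=> A' GA'; rewrite -E; exact: H0.
have H2 A B C : measurable A -> measurable B -> @RGenOpens.G R C ->
   (\int[mu]_(x in Q `&` (X @^-1` A `&` Y @^-1` B `&` Z @^-1` C)) f x = 0)%E.
  move=> mA mB GC.
  have E B' : Q `&` (X @^-1` A `&` Y @^-1` B' `&` Z @^-1` C) =
      (Q `&` (X @^-1` A `&` Z @^-1` C)) `&` Y @^-1` B'.
    by rewrite -!setIA; congr (_ `&` (_ `&` _)); rewrite setIC.
  rewrite E; apply: (integral0_preimage sG iG) => //.
  - by apply: measurableI => //; apply: measurableI; [exact: pX|apply: pZ;
    exact: mG].
  - by apply: sub; apply: measurableI; [exact: pX|apply: pZ; exact: mG].
  - rewrite (_ : _ `&` _ = Q `&` (X @^-1` A `&` Y @^-1` setT `&` Z @^-1` C));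
    last first.
      by rewrite preimage_setT setIT.
    rewrite QE setTI -(setIid I2) -QE; exact: H1.
  - by move=> A' GA'; rewrite -E; exact: H1.
have H3 A B C : measurable A -> measurable B -> measurable C ->
   (\int[mu]_(x in Q `&` (X @^-1` A `&` Y @^-1` B `&` Z @^-1` C)) f x = 0)%E.
  move=> mA mB mC.
  have E C' : Q `&` (X @^-1` A `&` Y @^-1` B `&` Z @^-1` C') =
      (Q `&` (X @^-1` A `&` Y @^-1` B)) `&` Z @^-1` C'.
    by rewrite -!setIA.
  rewrite E; apply: (integral0_preimage sG iG) => //.
  - by apply: measurableI => //; apply: measurableI; [exact: pX|exact: pY].
  - by apply: sub; apply: measurableI; [exact: pX|exact: pY].
  - rewrite (_ : _ `&` _ = Q `&` (X @^-1` A `&` Y @^-1` B `&` Z @^-1` setT));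
    last first.
      by rewrite preimage_setT setIT.
    rewrite QE setTI -(setIid I3) -QE; exact: H2.
  - by move=> A' GA'; rewrite -E; exact: H2.
have Q0 : (\int[mu]_(x in Q) f x = 0)%E by have := f0 p q; rewrite setIid.
(* The product is nested to the left, so rectangles generate its sigma-algebra in two stages: the
   pair of the first two coordinates, then the third. *)
have H4 (S : set (measurableTypeR R * measurableTypeR R)) C :
    measurable S -> measurable C ->
    (\int[mu]_(x in (Q `&` Z @^-1` C) `&` fst @^-1` S) f x = 0)%E.
  move=> mS mC.
  apply: (@integral0_preimage _ _ _ mu f _
    (measurableTypeR R * measurableTypeR R)%type _ _ fst
    (measurable_prod_measurableType _ _) (@setI_closed_rectangle _ _ _ _)) => //.
  - by apply: measurableI => //; exact: pZ.
  - by apply: sub; exact: pZ.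
  - rewrite (_ : _ `&` _ = Q `&` (X @^-1` setT `&` Y @^-1` setT `&` Z @^-1`
    C)); last first.
      by rewrite !preimage_setT !setTI.
    exact: H3.
  - move=> _ [A mA [B mB <-]].
    rewrite (_ : _ `&` fst @^-1` _ = Q `&` (X @^-1` A `&` Y @^-1` B `&` Z @^-1`
      C)); first exact: H3.
    by apply/seteqP; split => x [] => [[? ?] [? ?]|? [[? ?] ?]].
have H5 (S : set (mR3 R)) : measurable S ->
    (\int[mu]_(x in Q `&` S) f x = 0)%E.
  move=> mS; rewrite -(preimage_id S).
  apply: (@integral0_preimage _ _ _ mu f _ (mR3 R) _ _ id
    (measurable_prod_measurableType _ _) (@setI_closed_rectangle _ _ _ _)) => //.
  move=> _ [A mA [B mB <-]].
  rewrite (_ : _ `&` id @^-1` _ = (Q `&` Z @^-1` B) `&` fst @^-1` A);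
    first exact: H4.
  by apply/seteqP; split => x [] => [? [? ?]|[? ?] ?].
apply: (@integral_ae_eq _ _ _ mu Q mQ (cst 0%E)) => //.
move=> E EQ mE; rewrite integral0.
by rewrite -(setIidr EQ) H5.
Qed.

End BoxZero.

Lemma Rdominated_convergence d (T : measurableType d) (R : realType)
    (mu : {measure set T -> \bar R}) (D : set T) (f_ : (T ->
      R)^nat) (f g : T -> R) :
  measurable D -> (forall n, measurable_fun D (f_ n)) -> measurable_fun D f ->
  (forall x, D x -> f_ n x @[n --> \oo] --> f x) ->
  mu.-integrable D (EFin \o g) -> (forall n x, D x -> `|f_ n x| <= g x) ->
  \int[mu]_(x in D) f_ n x @[n --> \oo] --> \int[mu]_(x in D) f x.
Proof.
move=> mD mf_ mf ff ig fg.
have [||||fi _ H] := @dominated_convergence _ _ _ mu _ mD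
  (fun n x => (f_ n x)%:E) (EFin \o f) (EFin \o g) _ _ _ ig.
- by move=> n; exact/measurable_EFinP.
- exact/measurable_EFinP.
- by apply: aeW => x Dx; apply: cvg_EFin; [exact: nearW|exact: ff].
- by apply: aeW => x n Dx; rewrite /= lee_fin; exact: fg.
rewrite /Rintegral; apply: fine_cvg; rewrite fineK; first exact: H.
exact: integrable_fin_num.
Qed.

Section BoxDensity.
Variable R : realType.
Local Notation mu := (leb3 R).
Local Notation lam := (@lebesgue_measure R).

Lemma lebesgue_itvoo_fin (a b : R) : lam `]a, b[%classic \is a fin_num.
Proof.
by rewrite lebesgue_measure_itv/=; case: ifP.
Qed.

Lemma measurable_smooth1 (a : R -> R) : smooth1 a -> measurable_fun setT a.
Proof.
by move=> sa; apply: continuous_measurable_fun; exact: smooth1_continuous.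
Qed.

Lemma integrable_smooth1 (a : R -> R) (p q : R) : smooth1 a ->
  (forall t, t \notin `]p, q[ -> a t = 0) -> lam.-integrable setT (EFin \o a).
Proof.
move=> sa a0.
have := @integrable_mkcond _ _ _ lam `[p, q]%classic (EFin \o a) (measurable_itv _).
rewrite (_ : (EFin \o a) \_ _ = EFin \o a).
  move=> <-; apply: continuous_compact_integrable; first exact: segment_compact.
  by apply: continuous_subspaceT; exact: smooth1_continuous.
apply/funext => t; rewrite /patch; case: ifPn => //= /negP h; rewrite a0//.
by apply/negP => h'; apply: h; rewrite inE/=; apply: subset_itvW h'.
Qed.

Lemma cvg_integral_bump (a b : R) :
  \int[lam]_t bump n a b t @[n --> \oo] --> fine (lam `]a, b[%classic).
Proof.
have -> : fine (lam `]a, b[%classic) = \int[lam]_t (\1_(`]a, b[%classic : set R) t).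
  by rewrite /Rintegral integral_indic// setIT.
apply: (@Rdominated_convergence _ _ R lam setT (fun n =>
  bump n a b) _ (\1_(`]a, b[%classic : set R))) => //.
- by move=> n; apply: measurable_smooth1; exact: smooth1_bump.
- by move=> x _; exact: cvg_bump.
- exact: integrable_indic_itv.
- move=> n x _; have /andP[b0 b1] := bump_itv n a b x.
  rewrite ger0_norm// indicE; have [//|] := boolP (x \in _);
    rewrite notin_setE/= => h.
  by rewrite bump0//; apply/negP.
Qed.

Lemma measurable_tens (a b c : R -> R) : continuous a -> continuous b ->
  continuous c -> measurable_fun (setT : set (mR3 R)) (tens a b c).
Proof. by move=> ? ? ?; apply: continuous_measurable3; exact: continuous_tens. Qed.

Lemma leb3_obox (p q : R3 R) : mu (obox p q) = (lam `]p.1.1, q.1.1[%classic *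
  lam `]p.1.2, q.1.2[%classic * lam `]p.2, q.2[%classic)%E.
Proof.
rewrite oboxE; apply: etrans.
  apply: (@product_measure1E _ _ _ _ R (lam \x lam)%E lam) => //.
  exact: measurableX.
by congr (_ * _)%E; apply: product_measure1E.
Qed.

Lemma leb3_obox_fin (p q : R3 R) : (mu (obox p q) < +oo)%E.
Proof.
by rewrite leb3_obox ltey_eq !fin_numM// lebesgue_itvoo_fin.
Qed.

(* For [k = 0] this is the fundamental lemma of the calculus of variations. *)
Lemma ae_box_density (g : mR3 R -> R) p q (k : R) :
  mu.-integrable (obox p q) (EFin \o g) ->
  (forall a b c, smooth1 a -> smooth1 b -> smooth1 c ->
    (forall t, t \notin `]p.1.1, q.1.1[ -> a t = 0) ->
    (forall t, t \notin `]p.1.2, q.1.2[ -> b t = 0) ->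
    (forall t, t \notin `]p.2, q.2[ -> c t = 0) ->
    \int[mu]_(x in obox p q) (tens a b c x * g x) =
    k * \int[lam]_t a t * \int[lam]_t b t * \int[lam]_t c t) ->
  \forall x \ae mu, obox p q x -> g x = k.
Proof.
move=> ig H.
have mQ := measurable_obox p q.
have mg : measurable_fun (obox p q : set (mR3 R)) g.
  by have /measurable_int/measurable_EFinP := ig.
have ik : mu.-integrable (obox p q) (cst k%:E).
  apply/integrableP; split => //=; rewrite integral_cst// lte_mul_pinfty//.
  exact: leb3_obox_fin.
suff : \forall x \ae mu, obox p q x -> ((EFin \o g) x - (cst k%:E) x)%E = 0%E.
  apply: aeS => x /[apply]; rewrite /= -EFinB => -[] /eqP.
  by rewrite subr_eq0 => /eqP.
apply: (@ae0_of_integral_box R (fun x => (EFin \o g) x - (cst k%:E) x)%E);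
  first exact: integrableB.
move=> a b.
pose A := maxpt p a; pose B := minpt q b.
have QI : obox p q `&` obox a b = obox A B := oboxI p q a b.
have sAB : obox A B `<=` obox p q by rewrite -QI; exact: subIsetl.
have mAB : measurable (obox A B : set (mR3 R)) by exact: measurable_obox.
rewrite QI integralB//; [|exact: integrableS ig|exact: integrableS ik].
rewrite integral_cst//.
(* Both sides of [H] at these bumps are followed to the limit: the left one tends to the integral of
   [g] over the smaller box, the right one to [k] times its volume. *)
pose psi n := tens (bump n A.1.1 B.1.1) (bump n A.1.2 B.1.2) (bump n A.2 B.2).
have lim1 : \int[mu]_(x in obox p q) (psi n x * g x) @[n --> \oo] -->
   \int[mu]_(x in obox A B) g x.
  rewrite -(setIidr sAB) Rintegral_mkcondr.
  apply: (@Rdominated_convergence _ _ _ _ _ _ _ (fun x => `|g x|)) => //.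
  - move=> n; apply: measurable_funM => //; apply: measurable_funTS.
    by apply: measurable_tens; apply: smooth1_continuous; exact: smooth1_bump.
  - by apply/measurable_restrict => //; rewrite (setIidr sAB);
    exact: measurable_funS mg.
  - move=> x _; rewrite (_ : (g \_ (obox A B)) x = \1_(`]A.1.1,
    B.1.1[%classic : set R) x.1.1 *
      \1_(`]A.1.2, B.1.2[%classic : set R) x.1.2 * \1_(`]A.2,
        B.2[%classic : set R) x.2 * g x).
      apply: cvgM; last exact: cvg_cst.
      by apply: cvgM; [apply: cvgM|]; exact: cvg_bump.
    rewrite oboxE /patch !indicE !in_setX.
    by do 3 case: (_ \in _); rewrite ?mul1r ?mul0r ?mulr0.
  - rewrite (_ : EFin \o _ = abse \o (EFin \o g))//.
    exact: integrable_abse.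
  - move=> n x _; rewrite normrM ler_piMl//.
    have L0 (s t r : R) : 0 <= bump n s t r by have /andP[] := bump_itv n s t r.
    have L1 (s t r : R) : bump n s t r <= 1 by have /andP[] := bump_itv n s t r.
    rewrite ger0_norm /psi /tens; last by rewrite (mulr_ge0 (mulr_ge0 (L0 _ _
      _) (L0 _ _ _)) (L0 _ _ _)).
    apply: mulr_ile1 => //; first exact: mulr_ge0.
    exact: mulr_ile1.
have lim2 : \int[mu]_(x in obox p q) (psi n x * g x) @[n --> \oo] --> k *
    fine (lam `]A.1.1, B.1.1[%classic) * fine (lam `]A.1.2, B.1.2[%classic) *
    fine (lam `]A.2, B.2[%classic).
  have -> : (fun n => \int[mu]_(x in obox p q) (psi n x * g x)) =
    (fun n => k * \int[lam]_t bump n A.1.1 B.1.1 t * \int[lam]_t bump n A.1.2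
      B.1.2 t *
       \int[lam]_t bump n A.2 B.2 t).
    have Z n (x1 x2 y1 y2 t : R) : t \notin `]x1, y1[ ->
      bump n (Num.max x1 x2) (Num.min y1 y2) t = 0.
      move=> h; apply: bump0; apply: contra h; rewrite !in_itv/= gt_max lt_min.
      by move=> /andP[/andP[-> _] /andP[-> _]].
    by apply/funext => n; apply: H; try exact: smooth1_bump; move=> t; exact: Z.
  apply: cvgM; [apply: cvgM; [apply: cvgM; [exact: cvg_cst|]|]|];
    exact: cvg_integral_bump.
have E := cvg_unique (@Rhausdorff R) lim1 lim2.
have -> : (\int[mu]_(x in obox A B) (EFin \o g) x = (\int[mu]_(x in obox A B) g
  x)%:E)%E.
  by rewrite /Rintegral fineK//; apply: integrable_fin_num => //;
    exact: integrableS ig.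
set m := (X in (_ - k%:E * X)%E); have -> : m = _ := leb3_obox A B.
rewrite E.
move: (lebesgue_itvoo_fin A.1.1 B.1.1) (lebesgue_itvoo_fin A.1.2 B.1.2)
  (lebesgue_itvoo_fin A.2 B.2).
case: (lam _) => // r1 _; case: (lam _) => // r2 _; case: (lam _) => // r3 _ /=.
transitivity ((k * r1 * r2 * r3 - k * (r1 * r2 * r3))%:E);
  last by congr (_%:E); ring.
by [].
Qed.

End BoxDensity.

(** * Square integrable functions and weak derivatives *)

Section SquareIntegrable.
Context d (T : measurableType d) (R : realType).
Variables (mu : {measure set T -> \bar R}) (D : set T).
Hypothesis mD : measurable D.
Implicit Types f g : T -> R.

Definition sqint f := measurable_fun D f /\ mu.-integrable D (fun x =>
  (f x ^+ 2)%:E).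

Lemma sqintM f g : sqint f -> sqint g -> mu.-integrable D (fun x => (f x * g x)%:E).
Proof.
move=> [mf f2] [mg g2].
apply: (@le_integrable _ _ _ mu D mD _ (fun x => (f x ^+ 2)%:E + (g x ^+ 2)%:E)%E).
- by apply/measurable_EFinP; exact: measurable_funM.
- move=> x Dx; rewrite -EFinD !abse_EFin lee_fin ler_norml.
  rewrite ger0_norm ?addr_ge0 ?sqr_ge0//.
  have := sqr_ge0 (f x + g x); have := sqr_ge0 (f x - g x).
  by have := sqr_ge0 (f x); have := sqr_ge0 (g x) => *; apply/andP; split; nra.
- exact: integrableD.
Qed.

Lemma sqint0 : sqint (cst 0).
Proof.
split; first exact: measurable_cst.
rewrite (_ : (fun _ => _) = cst 0%E); first exact: integrable0.
by apply/funext => x; rewrite /= expr0n.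
Qed.

Lemma sqintD f g : sqint f -> sqint g -> sqint (fun x => f x + g x).
Proof.
move=> sf sg; have fg := sqintM sf sg; case: sf sg => mf f2 [mg g2].
split; first exact: measurable_funD.
rewrite (_ : (fun x => _) = (fun x => (f x ^+ 2)%:E + (g x ^+ 2)%:E +
    (2%:E * (f x * g x)%:E))%E).
  by apply: integrableD => //; [exact: integrableD|exact: integrableZl].
by apply/funext => x; rewrite -EFinM -!EFinD; congr (_%:E); ring.
Qed.

Lemma sqintZ f (k : R) : sqint f -> sqint (fun x => k * f x).
Proof.
move=> [mf f2]; split; first exact: measurable_funM.
rewrite (_ : (fun x => _) = (fun x => (k ^+ 2)%:E * (f x ^+ 2)%:E)%E).
  exact: integrableZl.
by apply/funext => x; rewrite -EFinM exprMn.
Qed.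

Lemma sqint_sum (I : finType) (F : I -> T -> R) :
  (forall i, sqint (F i)) -> sqint (fun x => \sum_i F i x).
Proof.
move=> sF; elim: (index_enum I) => [|i s ih].
  by rewrite (_ : (fun x => _) = cst 0); [exact: sqint0|apply/funext => x;
    rewrite big_nil].
rewrite (_ : (fun x => _) = (fun x => F i x + \sum_(j <- s) F j x));
  first exact: sqintD.
by apply/funext => x; rewrite big_cons.
Qed.

Hypothesis fD : (mu D < +oo)%E.

Lemma sqint_cst (k : R) : sqint (cst k).
Proof.
split; first exact: measurable_cst.
apply/integrableP; split => //=; rewrite integral_cst//.
exact: lte_mul_pinfty.
Qed.

Lemma sqint_integrable f : sqint f -> mu.-integrable D (EFin \o f).
Proof.
move=> sf; have := sqintM sf (sqint_cst 1).
by congr (mu.-integrable _ _); apply/funext => x; rewrite mulr1.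
Qed.

End SquareIntegrable.

(** * Inner products of square integrable fields *)

Section L2Theory.
Variables (R : realType) (Om : set (R3 R)).
Hypothesis mOm : measurable (Om : set (mR3 R)).
Local Notation mu := (leb3 R).

Lemma dotvE n (a b : 'cV[R]_n) : dotv a b = \sum_i a i 0 * b i 0.
Proof. by rewrite /dotv mxE; apply: eq_bigr => i _; rewrite mxE. Qed.

Lemma dotvC n (a b : 'cV[R]_n) : dotv a b = dotv b a.
Proof. by rewrite !dotvE; apply: eq_bigr => i _; rewrite mulrC. Qed.

Lemma L2P n (f : R3 R -> 'cV[R]_n) :
  L2 Om f <-> forall i, sqint mu (Om : set (mR3 R)) (fun x : mR3 R => f x i 0).
Proof.
split=> [[mf fi] i|sf].
  split; first exact: mf.
  apply/integrableP; split.
    by apply/measurable_EFinP; exact: measurable_funX.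
  apply: le_lt_trans fi; apply: ae_ge0_le_integral => [x _|x _|].
  - exact: abse_ge0.
  - by rewrite lee_fin dotvE; apply: sumr_ge0 => k _; rewrite -expr2 sqr_ge0.
  apply: aeW => x _; rewrite /= lee_fin ger0_norm ?sqr_ge0// dotvE.
  rewrite (bigD1 i)//= -expr2 lerDl; apply: sumr_ge0 => k _.
  by rewrite -expr2 sqr_ge0.
split=> [i|]; first by case: (sf i).
have -> : (\int[mu]_(x in Om) (dotv (f x) (f x))%:E)%E =
   (\int[mu]_(x in Om) (\sum_(i < n) (f x i 0 ^+ 2)%:E))%E.
  by apply: eq_integral => x _; rewrite dotvE -sumEFin.
rewrite -ge0_fin_numE; last first.
  by apply: integral_ge0 => x _; apply: sume_ge0 => i _; rewrite lee_fin sqr_ge0.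
by apply: integrable_fin_num => //; apply: integrable_sum => // i _; case: (sf i).
Qed.

Lemma L2D n (f g : R3 R -> 'cV[R]_n) : L2 Om f -> L2 Om g -> L2 Om (f + g).
Proof.
move=> /L2P sf /L2P sg; apply/L2P => i.
have := sqintD mOm (sf i) (sg i).
by congr (sqint _ _ _); apply/funext => x; rewrite mxE.
Qed.

Lemma L2Z n (f : R3 R -> 'cV[R]_n) (k : R) : L2 Om f -> L2 Om (k *: f).
Proof.
move=> /L2P sf; apply/L2P => i; have := sqintZ mOm k (sf i).
by congr (sqint _ _ _); apply/funext => x; rewrite mxE.
Qed.

Lemma L2_0 n : L2 Om (0 : R3 R -> 'cV[R]_n).
Proof.
apply/L2P => i; have := sqint0 mu (Om : set (mR3 R)).
by congr (sqint _ _ _); apply/funext => x; rewrite mxE.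
Qed.

Lemma L2_app_mx p n (A : 'M[R]_(p, n)) (f : R3 R -> 'cV[R]_n) :
  L2 Om f -> L2 Om (app_mx A f).
Proof.
move=> /L2P sf; apply/L2P => i.
have := sqint_sum mOm (fun j => sqintZ mOm (A i j) (sf j)).
by congr (sqint _ _ _); apply/funext => x; rewrite /app_mx mxE.
Qed.

Lemma L2_comb n m (x : 'I_m -> R) (F : 'I_m -> R3 R -> 'cV[R]_n) :
  (forall j, L2 Om (F j)) -> L2 Om (\sum_j x j *: F j).
Proof.
move=> LF; elim/big_ind: _; [exact: L2_0|by move=> f g; exact: L2D|].
by move=> j _; exact: L2Z.
Qed.

Lemma L2_integrable_dotv n (f g : R3 R -> 'cV[R]_n) : L2 Om f -> L2 Om g ->
  mu.-integrable (Om : set (mR3 R)) (fun x => (dotv (f x) (g x))%:E).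
Proof.
move=> /L2P sf /L2P sg.
rewrite (_ : (fun x => _) = (fun x => \sum_(i < n) (f x i 0 * g x i 0)%:E)%E).
  by apply: integrable_sum => // i _; exact: sqintM.
by apply/funext => x; rewrite dotvE -sumEFin.
Qed.

Lemma ipL2C n (f g : R3 R -> 'cV[R]_n) : ipL2 Om f g = ipL2 Om g f.
Proof. by rewrite /ipL2; apply: eq_Rintegral => x _; rewrite dotvC. Qed.

Lemma ipL2Dl n (f g h : R3 R -> 'cV[R]_n) : L2 Om f -> L2 Om g -> L2 Om h ->
  ipL2 Om (f + g) h = ipL2 Om f h + ipL2 Om g h.
Proof.
move=> Lf Lg Lh; rewrite /ipL2 -RintegralD//; try exact: L2_integrable_dotv.
by apply: eq_Rintegral => x _; rewrite /dotv linearD/= mulmxDl mxE.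
Qed.

Lemma ipL2Zl n (k : R) (f h : R3 R -> 'cV[R]_n) : L2 Om f -> L2 Om h ->
  ipL2 Om (k *: f) h = k * ipL2 Om f h.
Proof.
move=> Lf Lh; rewrite /ipL2 -RintegralZl//; last exact: L2_integrable_dotv.
by apply: eq_Rintegral => x _; rewrite /dotv linearZ/= -scalemxAl mxE.
Qed.

Lemma ipL2_0l n (h : R3 R -> 'cV[R]_n) : ipL2 Om 0 h = 0.
Proof.
rewrite /ipL2 (_ : (fun x => _) = cst 0).
  by rewrite Rintegral_cst// mul0r.
by apply/funext => x; rewrite /dotv trmx0 mul0mx mxE.
Qed.

Lemma ipL2_combl n m (x : 'I_m -> R) (F : 'I_m -> R3 R -> 'cV[R]_n) h :
  (forall j, L2 Om (F j)) -> L2 Om h ->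
  ipL2 Om (\sum_j x j *: F j) h = \sum_j x j * ipL2 Om (F j) h.
Proof.
move=> LF Lh.
suff [] : L2 Om (\sum_j x j *: F j) /\
  ipL2 Om (\sum_j x j *: F j) h = \sum_j x j * ipL2 Om (F j) h by [].
elim/big_ind2: _ => [|f a g b [Lf <-] [Lg <-]|j _].
- by split; [exact: L2_0|exact: ipL2_0l].
- by split; [exact: L2D|exact: ipL2Dl].
- by split; [exact: L2Z|exact: ipL2Zl].
Qed.

Lemma ipL2_ae n (f f' g g' : R3 R -> 'cV[R]_n) :
  ae_eqOm Om f f' -> ae_eqOm Om g g' -> ipL2 Om f g = ipL2 Om f' g'.
Proof.
move=> ff gg; rewrite /ipL2; apply: ae_Rintegral.
by apply: aeS2 ff gg => x fx gx Ox; rewrite fx// gx.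
Qed.

Lemma ipL2_comb n m k (x : 'I_m -> R) (y : 'I_k -> R)
    (F : 'I_m -> R3 R -> 'cV[R]_n) (G : 'I_k -> R3 R -> 'cV[R]_n) f g :
  (forall j, L2 Om (F j)) -> (forall j, L2 Om (G j)) ->
  ae_eqOm Om f (\sum_j x j *: F j) -> ae_eqOm Om g (\sum_j y j *: G j) ->
  ipL2 Om f g = \sum_i \sum_j x i * y j * ipL2 Om (F i) (G j).
Proof.
move=> LF LG fF gG; rewrite (ipL2_ae fF gG) ipL2_combl//; last exact: L2_comb.
apply: eq_bigr => i _; rewrite ipL2C ipL2_combl// mulr_sumr.
by apply: eq_bigr => j _; rewrite ipL2C mulrA.
Qed.

Lemma ipL2_ge0 n (f : R3 R -> 'cV[R]_n) : 0 <= ipL2 Om f f.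
Proof.
apply: Rintegral_ge0 => x _; rewrite dotvE; apply: sumr_ge0 => k _.
by rewrite -expr2 sqr_ge0.
Qed.

Lemma ipL2_eq0 n (f : R3 R -> 'cV[R]_n) : L2 Om f -> ipL2 Om f f = 0 ->
  ae_eqOm Om f 0.
Proof.
move=> Lf f0; have fi := L2_integrable_dotv Lf Lf.
have h0 x : 0 <= dotv (f x) (f x).
  by rewrite dotvE; apply: sumr_ge0 => k _; rewrite -expr2 sqr_ge0.
have : ae_eq mu (Om : set (mR3 R)) (fun x => (dotv (f x) (f x))%:E) (cst 0%E).
  apply/(ae_eq_integral_abs mu mOm (measurable_int _ fi)).
  under eq_integral do rewrite gee0_abs ?lee_fin//.
  have /integrable_fin_num := fi => /(_ mOm) /fineK <-.
  by rewrite -[fine _]/(ipL2 Om f f) f0.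
apply: aeS => x /[apply] -[] H; apply/matrixP => i j; rewrite ord1 mxE.
move: H; rewrite dotvE => /eqP; rewrite psumr_eq0; last first.
  by move=> k _; rewrite -expr2 sqr_ge0.
by move=> /allP /(_ i); rewrite mem_index_enum => /(_ isT) /=;
  rewrite mulf_eq0 orbb => /eqP.
Qed.

End L2Theory.

(** * Distributional images under first-order operators *)

Section WeakImage.
Variables (R : realType) (Om : set (R3 R)).
Hypothesis oOm : open Om.
Local Notation mu := (leb3 R).
Hypothesis fOm : (mu Om < +oo)%E.

Let mOm : measurable (Om : set (mR3 R)) := open_measurable3 oOm.

Lemma compact_supp_bounded (f : R3 R -> R) (K : set (R3 R)) :
  continuous f -> compact K -> (forall x, ~ K x -> f x = 0) ->
  exists M, forall x, `|f x| <= M.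
Proof.
move=> cf cK f0.
have /compact_bounded[M [_ HM]] : compact (f @` K).
  by apply: continuous_compact => //; exact: continuous_subspaceT.
exists (`|M| + 1) => x; have [Kx|/f0->] := pselect (K x); last by rewrite normr0.
by apply: HM; [rewrite (le_lt_trans (ler_norm M))// ltrDl|exists x].
Qed.

Lemma test_fun_bounded psi : test_fun Om psi -> exists M, forall x, `|psi x| <= M.
Proof.
move=> [sp [K [cK _ p0]]]; apply: compact_supp_bounded cK p0.
by have [] := sp [::].
Qed.

Lemma cgrad_bounded psi (i : 'I_3) : test_fun Om psi ->
  exists M, forall x, `|cgrad psi x i 0| <= M.
Proof.
move=> [sp [K [cK _ p0]]].
have [M HM] : exists M, forall x, `|'D_(edir R i) psi x| <= M.
  apply: (compact_supp_bounded _ cK); first by have [] := sp [:: i].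
  (* Off the closed set [K] the function vanishes in a whole neighbourhood, so its derivatives
     vanish there too. *)
  move=> x Kx; have oK : open (~` K).
    by apply: closed_openC; apply: compact_closed => //; exact: norm_hausdorff.
  rewrite (@near_eq_derive _ _ _ psi (cst 0)) ?derive_cst//.
  by near=> y; apply: p0; near: y; exact: open_nbhs_nbhs.
by exists M => x; rewrite mxE.
Unshelve. all: by end_near. Qed.

Lemma test_fun_continuous psi : test_fun Om psi -> continuous psi.
Proof. by move=> [/(_ [::])[]]. Qed.

Lemma cgrad_continuous psi (i : 'I_3) : test_fun Om psi ->
  continuous (fun x => cgrad psi x i 0).
Proof.
move=> [/(_ [:: i])[+ _] _] => /= c.
by rewrite (_ : (fun x => _) = 'D_(edir R i) psi)//; apply/funext => x; rewrite mxE.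
Qed.

Lemma integrable_boundedM (b f : R3 R -> R) : continuous b ->
  (exists M, forall x, `|b x| <= M) -> sqint mu (Om : set (mR3 R)) f ->
  mu.-integrable (Om : set (mR3 R)) (fun x => (b x * f x)%:E).
Proof.
move=> cb [M bM] sf.
have := sqint_integrable mOm fOm sf.
apply: (integrableMr mOm) => //.
  by apply: measurable_funTS; exact: continuous_measurable3.
exists M; split; first exact: num_real.
by move=> N MN x _; rewrite /= (le_trans (bM x))// ltW.
Qed.

(** [weak_image] accepts any function as symbol. Linearity turns [A (cgrad psi x) *m f x] into a
    finite sum of bounded times square integrable functions, so that integrals can be added. *)
Definition linear_symbol p n (A : 'cV[R]_3 -> 'M[R]_(p, n)) :=
  exists al : 'I_3 -> 'M[R]_(p, n), forall xi, A xi = \sum_l xi l 0 *: al l.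

Section Linear.
Variables (p n : nat) (A : 'cV[R]_3 -> 'M[R]_(p, n)).
Hypothesis lA : linear_symbol A.
Implicit Types (f : R3 R -> 'cV[R]_n) (g : R3 R -> 'cV[R]_p).

Lemma integrable_symbol psi f (i : 'I_p) : test_fun Om psi -> L2 Om f ->
  mu.-integrable (Om : set (mR3 R)) (fun x => ((A (cgrad psi x) *m f x) i 0)%:E).
Proof.
move=> tp Lf; have [al Al] := lA.
rewrite (_ : (fun x => _) =
    (fun x => \sum_(l < 3) (cgrad psi x l 0 * (app_mx (al l) f x) i 0)%:E)%E).
  apply: integrable_sum => // l _; apply: integrable_boundedM.
  - exact: cgrad_continuous.
  - exact: cgrad_bounded.
  - exact: ((L2P mOm _).1 (L2_app_mx mOm (al l) Lf) i).
apply/funext => x; rewrite Al mulmx_suml summxE -sumEFin; apply: eq_bigr => l _.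
by rewrite -scalemxAl mxE.
Qed.

Lemma integrable_test psi g (i : 'I_p) : test_fun Om psi -> L2 Om g ->
  mu.-integrable (Om : set (mR3 R)) (fun x => (psi x * g x i 0)%:E).
Proof.
move=> tp Lg; apply: integrable_boundedM.
- exact: test_fun_continuous.
- exact: test_fun_bounded.
- exact: ((L2P mOm _).1 Lg i).
Qed.

Lemma weak_imageD f f' g g' : L2 Om f -> L2 Om f' -> L2 Om g -> L2 Om g' ->
  weak_image Om A f g -> weak_image Om A f' g' -> weak_image Om A (f + f') (g + g').
Proof.
move=> Lf Lf' Lg Lg' W W' psi tp i.
transitivity (\int[mu]_(x in Om) (psi x * g x i 0 + psi x * g' x i 0)).
  by apply: eq_Rintegral => x _; rewrite mxE mulrDr.
rewrite RintegralD//; try exact: integrable_test.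
rewrite W// W'// -opprD -RintegralD//; try exact: integrable_symbol.
by congr (- _); apply: eq_Rintegral => x _; rewrite (_ : (f + f') x = f x + f'
  x)// mulmxDr [RHS]mxE.
Qed.

Lemma weak_imageZ k f g : L2 Om f -> L2 Om g ->
  weak_image Om A f g -> weak_image Om A (k *: f) (k *: g).
Proof.
move=> Lf Lg W psi tp i.
transitivity (\int[mu]_(x in Om) (k * (psi x * g x i 0))).
  by apply: eq_Rintegral => x _; rewrite mxE mulrCA.
rewrite RintegralZl//; last exact: integrable_test.
rewrite W// mulrN -RintegralZl//; last exact: integrable_symbol.
by congr (- _); apply: eq_Rintegral => x _; rewrite (_ : (k *: f) x = k *: f
  x)// -scalemxAr [RHS]mxE.
Qed.

Lemma weak_image0 : weak_image Om A 0 0.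
Proof.
move=> psi tp i.
rewrite (_ : (fun x => _) = cst 0); last by apply/funext => x; rewrite mxE mulr0.
rewrite [X in - X](_ : _ = \int[mu]_(x in Om) 0).
  by rewrite Rintegral_cst// mul0r oppr0.
by apply: eq_Rintegral => x _; rewrite mulmx0 mxE.
Qed.

Lemma weak_image_comb m (x : 'I_m -> R) (F : 'I_m -> R3 R -> 'cV[R]_n)
    (G : 'I_m -> R3 R -> 'cV[R]_p) :
  (forall j, L2 Om (F j)) -> (forall j, L2 Om (G j)) ->
  (forall j, weak_image Om A (F j) (G j)) ->
  weak_image Om A (\sum_j x j *: F j) (\sum_j x j *: G j).
Proof.
move=> LF LG W.
suff [] : [/\ L2 Om (\sum_j x j *: F j), L2 Om (\sum_j x j *: G j) &
  weak_image Om A (\sum_j x j *: F j) (\sum_j x j *: G j)] by [].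
elim/big_ind2: _ => [|f a g b [Lf Lg Wf] [Lg' Lg'' Wg]|j _].
- by split; [exact: L2_0|exact: L2_0|exact: weak_image0].
- by split; [exact: L2D|exact: L2D|exact: weak_imageD].
- by split; [exact: L2Z|exact: L2Z|exact: weak_imageZ].
Qed.

End Linear.

Lemma weak_image_ae p n (A : 'cV[R]_3 -> 'M[R]_(p, n)) f f' g g' :
  ae_eqOm Om f f' -> ae_eqOm Om g g' -> weak_image Om A f g ->
    weak_image Om A f' g'.
Proof.
move=> ff gg W psi tp i.
transitivity (\int[mu]_(x in Om) (psi x * g x i 0)).
  by apply: ae_Rintegral; apply: aeS gg => x gx Ox; rewrite gx.
rewrite W//; congr (- _).
by apply: ae_Rintegral; apply: aeS ff => x fx Ox; rewrite fx.
Qed.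

Lemma Rintegral_supp (D : set (mR3 R)) (F : mR3 R -> R) : D `<=` Om ->
  (forall x, ~ D x -> F x = 0) ->
  \int[mu]_(x in Om) F x = \int[mu]_(x in D) F x.
Proof.
move=> DO F0; rewrite Rintegral_mkcond [RHS]Rintegral_mkcond.
congr (Rintegral _ _ _); apply/funext => x; rewrite /patch.
have [xO|xO] := boolP (x \in _); have [xD|xD] := boolP (x \in _) => //.
- by apply: F0 => Dx; move/negP: xD; apply; rewrite inE.
- by move/negP: xO; case; rewrite inE; apply: DO; rewrite inE in xD.
Qed.

Lemma tens_supp (a b c : R -> R) (p q : R3 R) x :
  (forall t, t \notin `]p.1.1, q.1.1[ -> a t = 0) ->
  (forall t, t \notin `]p.1.2, q.1.2[ -> b t = 0) ->
  (forall t, t \notin `]p.2, q.2[ -> c t = 0) ->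
  ~ obox p q x -> tens a b c x = 0.
Proof.
move=> a0 b0 c0; rewrite oboxE /tens => nx.
have [xa|/a0->] := boolP (x.1.1 \in `]p.1.1, q.1.1[); last by rewrite !mul0r.
have [xb|/b0->] := boolP (x.1.2 \in `]p.1.2, q.1.2[); last by rewrite mulr0 mul0r.
have [xc|/c0->] := boolP (x.2 \in `]p.2, q.2[); last by rewrite mulr0.
by case: nx; split.
Qed.

Lemma notin_cc_oo (a : R -> R) (p q : R) :
  (forall t, t \notin `]p, q[ -> a t = 0) -> (forall t, t \notin `[p, q] ->
    a t = 0).
Proof.
by move=> H t /negP h; apply: H; apply/negP => h'; apply: h; exact: subset_itvW h'.
Qed.

Lemma box_sub_integrable (g : R3 R -> R) (p q : R3 R) : cbox p q `<=` Om ->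
  sqint mu (Om : set (mR3 R)) g -> mu.-integrable (obox p q : set (mR3 R))
    (EFin \o g).
Proof.
move=> pqO sg; apply: integrableS (sqint_integrable mOm fOm sg) => //.
  exact: measurable_obox.
exact: subset_trans (@obox_cbox _ _ _) pqO.
Qed.

(** Tensor bumps on a closed box inside [Om] are test functions, so every such box falls under
    [ae_box_density] with [k = 0]. *)
Lemma ae0_of_test (g : R3 R -> R) : sqint mu (Om : set (mR3 R)) g ->
  (forall psi, test_fun Om psi -> \int[mu]_(x in Om) (psi x * g x) = 0) ->
  \forall x \ae mu, Om x -> g x = 0.
Proof.
move=> sg H; apply: ae_from_boxes => // p q pqO.
apply: ae_box_density; first exact: box_sub_integrable.
move=> a b c sa sb sc a0 b0 c0; rewrite !mul0r.
rewrite -(H (tens a b c)); last first.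
  by apply: test_fun_tens pqO _ _ _ => //; exact: notin_cc_oo.
apply/esym; apply: Rintegral_supp.
  exact: subset_trans (@obox_cbox _ _ _) pqO.
by move=> x nx; rewrite (tens_supp a0 b0 c0 nx) mul0r.
Qed.

Lemma weak_image_unique p n (A : 'cV[R]_3 -> 'M[R]_(p, n)) f g g' :
  L2 Om g -> L2 Om g' -> weak_image Om A f g -> weak_image Om A f g' ->
  ae_eqOm Om g g'.
Proof.
move=> Lg Lg' W W'.
have H (i : 'I_p) : \forall x \ae mu, Om x -> g x i 0 - g' x i 0 = 0.
  apply: ae0_of_test.
    have LB : L2 Om (g + (-1) *: g') by apply: L2D => //; exact: L2Z.
    have := (L2P mOm _).1 LB i.
    by congr (sqint _ _ _); apply/funext => x; rewrite !mxE mulN1r.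
  move=> psi tp.
  under eq_Rintegral do rewrite mulrBr.
  rewrite RintegralB//; try exact: integrable_test.
  by rewrite W// W'// subrr.
have : \forall x \ae mu, forall i, Om x -> g x i 0 - g' x i 0 = 0.
  exact: ae_forall_fin.
by apply: aeS => x hx Ox; apply/matrixP => i j; rewrite ord1; apply/eqP;
  rewrite -subr_eq0; apply/eqP/hx.
Qed.

(** The way to compute [wop]: exhibiting one square integrable image ensures that [xget] does not
    return its default, and uniqueness identifies the result with the exhibited image. *)
Lemma wopP p n (A : 'cV[R]_3 -> 'M[R]_(p, n)) f g :
  L2 Om g -> weak_image Om A f g ->
  [/\ L2 Om (wop Om A f), weak_image Om A f (wop Om A f) & ae_eqOm Om (wop Om A
    f) g].
Proof.
move=> Lg W; have [L' W'] : L2 Om (wop Om A f) /\ weak_image Om A f (wop Om A f).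
  by apply: (@xgetPex _ (fun=> 0) [set g | L2 Om g /\ weak_image Om A f g]);
    exists g.
by split => //; exact: (weak_image_unique L' Lg W' W).
Qed.

Lemma Hop_wop p n (A : 'cV[R]_3 -> 'M[R]_(p, n)) f :
  Hop Om A f -> L2 Om (wop Om A f) /\ weak_image Om A f (wop Om A f).
Proof. by move=> [_ [g [Lg W]]]; have [] := wopP Lg W. Qed.

(** The representatives chosen by [wop] need not add up pointwise. But the combination of the chosen
    images is an image of [f], since [weak_image] does not see null sets, and images are unique. *)
Lemma wop_comb p n (A : 'cV[R]_3 -> 'M[R]_(p, n)) m (x : 'I_m -> R)
    (F : 'I_m -> R3 R -> 'cV[R]_n) f : linear_symbol A ->
  (forall j, Hop Om A (F j)) -> ae_eqOm Om f (\sum_j x j *: F j) ->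
  ae_eqOm Om (wop Om A f) (\sum_j x j *: wop Om A (F j)).
Proof.
move=> lA HF fF.
have LW j := (Hop_wop (HF j)).1.
have W : weak_image Om A f (\sum_j x j *: wop Om A (F j)).
  apply: (@weak_image_ae _ _ A (\sum_j x j *: F j) _ (\sum_j x j *: wop Om A (F
    j))).
  - by apply: aeS fF => y fy Oy; rewrite fy.
  - exact/aeW.
  - by apply: weak_image_comb => // j; [case: (HF j)|exact: (Hop_wop (HF j)).2].
by have [] := wopP (L2_comb mOm x LW) W.
Qed.

Lemma linear_grad : linear_symbol (@grad_symbol R).
Proof.
exists (fun l => delta_mx l 0) => xi; apply/matrixP => i j.
rewrite ord1 summxE (bigD1 i)//= big1 ?addr0 => [|k ki]; rewrite !mxE !eqxx/=.
  by rewrite mulr1.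
by rewrite [i == k]eq_sym (negbTE ki) mulr0.
Qed.

Lemma linear_voigt : linear_symbol (@voigt_symbol R).
Proof.
exists (fun l => voigt_symbol (delta_mx l 0)) => xi; apply/matrixP => i j.
rewrite summxE !big_ord_recl big_ord0 addr0 !mxE.
case: i => -[|[|[|[|[|[|//]]]]]] ilt; case: j => -[|[|[|//]]] jlt;
  rewrite /= ?mxE/= ?mulr0 ?mulr1 ?addr0 ?add0r//;
  congr (xi _ _); exact: val_inj.
Qed.

End WeakImage.

(** * Functions with zero gradient *)

Section ZeroGradient.
Variable R : realType.
Local Notation mu := (leb3 R).
Local Notation lam := (@lebesgue_measure R).

Lemma open_obox (p q : R3 R) : open (obox p q).
Proof.
have -> : obox p q = (fun x => x.1.1) @^-1` `]p.1.1, q.1.1[%classic `&`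
    ((fun x => x.1.2) @^-1` `]p.1.2, q.1.2[%classic `&` snd @^-1` `]p.2,
      q.2[%classic).
  by rewrite oboxE; apply/seteqP; split => x; [move=> [[]]|move=> [? []]].
apply: openI; [|apply: openI].
- apply: open_comp => [x _|]; last exact: interval_open.
  by apply: continuous_comp; exact: cvg_fst.
- apply: open_comp => [x _|]; last exact: interval_open.
  by apply: continuous_comp; [exact: cvg_fst|exact: cvg_snd].
- by apply: open_comp => [x _|]; [exact: cvg_snd|exact: interval_open].
Qed.

Definition bump_fun (p q : R) (a : R -> R) :=
  smooth1 a /\ (forall t, t \notin `]p, q[ -> a t = 0).

Lemma bump_fun_integrable p q a : bump_fun p q a ->
  lam.-integrable setT (EFin \o a).
Proof. by move=> [sa a0]; exact: integrable_smooth1 a0. Qed.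

Lemma bump_fun_comb p q a b (k : R) : bump_fun p q a -> bump_fun p q b ->
  bump_fun p q (fun t => a t + k * b t).
Proof.
move=> [/smooth1P sa a0] [/smooth1P sb b0]; split; last first.
  by move=> t tpq; rewrite a0// b0// mulr0 addr0.
apply/smooth1P => j; apply: (@CnD _ _ a (fun t => k * b t)) => //.
by apply: (@CnM _ _ (cst k) b) => //; exact: Cn_cst.
Qed.

(** The primitive starting at minus infinity vanishes up to [p]; beyond [q] it equals the total
    integral, and this is where the zero mean enters. *)
Lemma bump_fun_antiderivative p q a : bump_fun p q a -> \int[lam]_t a t = 0 ->
  exists2 F, bump_fun p q F & derive1 F = a.
Proof.
move=> ba; have [sa a0] := ba => la.
pose F x := \int[lam]_(t in `]-oo, x]) a t.
have ia := bump_fun_integrable ba.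
have dF x : derivable F x 1 /\ derive1 F x = a x.
  apply: (@continuous_FTC1 _ a -oo%O x (x + 1)) => //.
  - by rewrite ltrDl.
  - by apply: integrableS ia.
  - exact: ltNyr.
  - exact: smooth1_continuous.
have F'a : derive1 F = a by apply/funext => x; have [] := dF x.
exists F => //; split.
  apply/smooth1P => -[|k] /=; rewrite ?F'a; split => //.
  - by move=> x; have [] := dF x.
  - by move=> x; have [] := dF x.
  - by move/smooth1P : sa.
move=> t; rewrite in_itv/= negb_and -!leNgt => /orP[tp|qt].
  rewrite /F (@eq_Rintegral _ _ _ lam _ (cst 0));
    first by rewrite Rintegral_cst// mul0r.
  move=> x; rewrite inE/= in_itv/= => xt; rewrite a0// in_itv/= negb_and -leNgt.
  by rewrite (le_trans xt tp).
rewrite /F -[RHS]la Rintegral_mkcond; congr (Rintegral _ _ _).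
apply/funext => x; rewrite /patch; case: ifPn => // /negP nx; apply/esym/a0.
apply/negP; rewrite in_itv/= => /andP[_ xq]; apply: nx.
by rewrite inE/= in_itv/= (le_trans (ltW xq)).
Qed.

Lemma bump_fun_norm p q : p < q -> exists2 a, bump_fun p q a & \int[lam]_t a t = 1.
Proof.
move=> pq; have := @cvg_integral_bump R p q.
(* The tolerance equals the limit [q - p], so some bump has a nonzero integral and can be
   normalized. *)
rewrite lebesgue_measure_itv/= lte_fin pq /= => /cvgrPdist_lt /(_ (q - p)).
rewrite subr_gt0 => /(_ pq) [n _ /(_ n (leqnn n))] /=.
set I := (\int[lam]_t _) => H.
have I0 : I != 0 by apply/eqP => I0; move: H; rewrite I0 subr0 ger0_norm
  ?ltxx// subr_ge0 ltW.
have bb : bump_fun p q (bump n p q) by split; [exact: smooth1_bump|move=> t;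
  exact: bump0].
have b0 : bump_fun p q (cst 0) by split => //; apply/smooth1P => k; exact: Cn_cst.
exists (fun t => 0 + I^-1 * bump n p q t); first exact: (bump_fun_comb _ b0 bb).
under eq_Rintegral do rewrite add0r.
by rewrite RintegralZl//; [rewrite mulVf|exact: bump_fun_integrable bb].
Qed.

Variable Om : set (R3 R).
Hypothesis oOm : open Om.
Hypothesis fOm : (mu Om < +oo)%E.
Let mOm : measurable (Om : set (mR3 R)) := open_measurable3 oOm.
Variable f : R3 R -> R.
Hypothesis sf : sqint mu (Om : set (mR3 R)) f.
Hypothesis wf : weak_image Om (@grad_symbol R) (vec1 f) 0.

Lemma zero_grad_test psi (i : 'I_3) : test_fun Om psi ->
  \int[mu]_(x in Om) ('D_(edir R i) psi x * f x) = 0.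
Proof.
move=> tp; have := wf tp i.
under eq_Rintegral do rewrite mxE mulr0.
rewrite Rintegral_cst// mul0r => /esym/eqP; rewrite oppr_eq0 => /eqP <-.
apply: eq_Rintegral => x _.
by rewrite /grad_symbol mxE big_ord_recl big_ord0 addr0 /cgrad /vec1 !mxE eqxx
  mulr1n.
Qed.

(** The argument of du Bois-Reymond, one variable at a time: [T a b c] depends on the bumps only
    through their three integrals, which is the hypothesis of [ae_box_density]. The constant is the
    value of [T] at bumps of integral 1. *)
Lemma zero_grad_box p q : cbox p q `<=` Om ->
  exists k, \forall x \ae mu, obox p q x -> f x = k.
Proof.
move=> pqO.
have [[p1 p2 p3]|] := pselect [/\ p.1.1 < q.1.1, p.1.2 < q.1.2 & p.2 < q.2];
  last first.
  move=> H; exists 0; apply: aeW => x [/andP[a b] /andP[a' b'] /andP[a'' b'']].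
  by exfalso; apply: H; split; [exact: lt_trans b|exact: lt_trans b'|exact:
    lt_trans b''].
pose T a b c := \int[mu]_(x in obox p q) (tens a b c x * f x).
pose B1 := bump_fun p.1.1 q.1.1; pose B2 := bump_fun p.1.2 q.1.2;
  pose B3 := bump_fun p.2 q.2.
have TE a b c : B1 a -> B2 b -> B3 c ->
    T a b c = \int[mu]_(x in Om) (tens a b c x * f x).
  move=> [_ a0] [_ b0] [_ c0]; apply/esym; apply: Rintegral_supp.
    exact: subset_trans (@obox_cbox _ _ _) pqO.
  by move=> x nx; rewrite (tens_supp a0 b0 c0 nx) mul0r.
have tt a b c : B1 a -> B2 b -> B3 c -> test_fun Om (tens a b c).
  move=> [? ?] [? ?] [? ?].
  by apply: test_fun_tens pqO _ _ _ => //; exact: notin_cc_oo.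
have it a b c : B1 a -> B2 b -> B3 c ->
    mu.-integrable (Om : set (mR3 R)) (fun x => (tens a b c x * f x)%:E).
  move=> Ba Bb Bc; apply: integrable_boundedM => //.
    exact: test_fun_continuous (tt _ _ _ Ba Bb Bc).
  exact: test_fun_bounded (tt _ _ _ Ba Bb Bc).
have Z a b c (i : 'I_3) : B1 a -> B2 b -> B3 c ->
    \int[mu]_(x in Om) (dtens i a b c x * f x) = 0.
  move=> Ba Bb Bc; have := zero_grad_test i (tt _ _ _ Ba Bb Bc).
  rewrite -(derive_tens i Ba.1 Bb.1 Bc.1). exact.
have [a0 Ba0 la0] := bump_fun_norm p1.
have [b0 Bb0 lb0] := bump_fun_norm p2.
have [c0 Bc0 lc0] := bump_fun_norm p3.
have l0 r s a e : bump_fun r s a -> bump_fun r s e -> \int[lam]_t e t = 1 ->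
    \int[lam]_t (a t + (- \int[lam]_t a t) * e t) = 0.
  move=> Ba Be le; have ia := bump_fun_integrable Ba;
    have ie := bump_fun_integrable Be.
  rewrite RintegralD//; last exact: (integrableZl (measurableT) (- \int[lam]_t
    a t) ie).
  by rewrite RintegralZl// le mulr1 subrr.
(* [a - (int a) a0] has integral zero, hence is the derivative of a bump, and
   [f] is orthogonal to the derivatives of test functions. *)
have X1 a b c : B1 a -> B2 b -> B3 c -> T a b c = (\int[lam]_t a t) * T a0 b c.
  move=> Ba Bb Bc; apply/eqP; rewrite -subr_eq0; apply/eqP.
  have BA := bump_fun_comb (- \int[lam]_t a t) Ba Ba0.
  have [F BF F'] := bump_fun_antiderivative BA (l0 _ _ _ _ Ba Ba0 la0).
  rewrite !TE// -RintegralZl//; last exact: it.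
  rewrite -RintegralB//; [|exact: it|].
    rewrite -[RHS](Z F b c (@Ordinal 3 0 isT))//; apply: eq_Rintegral => x _.
    by rewrite /dtens/= F' /tens; ring.
  exact: (integrableZl mOm (\int[lam]_t a t) (it _ _ _ Ba0 Bb Bc)).
have X2 a b c : B1 a -> B2 b -> B3 c -> T a b c = (\int[lam]_t b t) * T a b0 c.
  move=> Ba Bb Bc; apply/eqP; rewrite -subr_eq0; apply/eqP.
  have BA := bump_fun_comb (- \int[lam]_t b t) Bb Bb0.
  have [F BF F'] := bump_fun_antiderivative BA (l0 _ _ _ _ Bb Bb0 lb0).
  rewrite !TE// -RintegralZl//; last exact: it.
  rewrite -RintegralB//; [|exact: it|].
    rewrite -[RHS](Z a F c (@Ordinal 3 1 isT))//; apply: eq_Rintegral => x _.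
    by rewrite /dtens/= F' /tens; ring.
  exact: (integrableZl mOm (\int[lam]_t b t) (it _ _ _ Ba Bb0 Bc)).
have X3 a b c : B1 a -> B2 b -> B3 c -> T a b c = (\int[lam]_t c t) * T a b c0.
  move=> Ba Bb Bc; apply/eqP; rewrite -subr_eq0; apply/eqP.
  have BA := bump_fun_comb (- \int[lam]_t c t) Bc Bc0.
  have [F BF F'] := bump_fun_antiderivative BA (l0 _ _ _ _ Bc Bc0 lc0).
  rewrite !TE// -RintegralZl//; last exact: it.
  rewrite -RintegralB//; [|exact: it|].
    rewrite -[RHS](Z a b F (@Ordinal 3 2 isT))//; apply: eq_Rintegral => x _.
    by rewrite /dtens/= F' /tens; ring.
  exact: (integrableZl mOm (\int[lam]_t c t) (it _ _ _ Ba Bb Bc0)).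
exists (T a0 b0 c0); apply: ae_box_density; first exact: (box_sub_integrable
  oOm fOm pqO sf).
move=> a b c sa sb sc za zb zc.
have Ba : B1 a by []. have Bb : B2 b by []. have Bc : B3 c by [].
rewrite -/(T a b c) X1// X2// X3//; ring.
Qed.

(** The common point makes the intersection a nondegenerate open box, of positive volume. *)
Lemma obox_overlap p q p' q' x k k' : obox p q x -> obox p' q' x ->
  (\forall x \ae mu, obox p q x -> f x = k) ->
  (\forall x \ae mu, obox p' q' x -> f x = k') -> k = k'.
Proof.
move=> xp xp' H H'; apply: contrapT => kk'.
pose A := maxpt p p'; pose B := minpt q q'.
have QI : obox A B = obox p q `&` obox p' q' by rewrite oboxI.
have [/andP[A1 B1] /andP[A2 B2] /andP[A3 B3]] : obox A B x by rewrite QI.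
have : (0 < mu (obox A B))%E.
  rewrite leb3_obox !lebesgue_measure_itv/= !lte_fin.
  rewrite (lt_trans A1 B1) (lt_trans A2 B2) (lt_trans A3 B3).
  by apply: mule_gt0; [apply: mule_gt0|]; rewrite -EFinB lte_fin subr_gt0;
    [exact: lt_trans A1 B1|exact: lt_trans A2 B2|exact: lt_trans A3 B3].
have : mu.-negligible (obox A B).
  have : \forall x \ae mu, ~ obox A B x.
    apply: aeS2 H H' => y Hy Hy'; rewrite QI => -[/Hy + /Hy'].
    by move=> -> /kk'.
  by apply: negligibleS => y ? /=; exact.
move/(measure_negligible (measurable_obox A B)) => m0.
rewrite (_ : mu _ = 0%E) ?ltxx//; exact: m0.
Qed.

(** The sets [C k] of points near which [f] is almost everywhere [k] are open, pairwise disjoint and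
    cover [Om], so connectedness leaves a single one. *)
Lemma zero_grad_const : connected Om -> exists k, \forall x \ae mu, Om x -> f x = k.
Proof.
move=> cOm; have [[x0 Ox0]|nO] := pselect (Om !=set0); last first.
  by exists 0; apply: aeW => x Ox; exfalso; apply: nO; exists x.
pose C k x := exists p q, [/\ obox p q x, cbox p q `<=` Om &
  \forall x \ae mu, obox p q x -> f x = k].
have ex x : Om x -> exists k, C k x.
  move=> Ox; have [p [q [pqx pqO]]] := open_box oOm Ox.
  have [k Hk] := zero_grad_box pqO.
  by exists k, (ratpt R p), (ratpt R q).
have CO k x : C k x -> Om x by move=> [p [q [/obox_cbox + pqO _]]]; exact: pqO.
have uC k k' x : C k x -> C k' x -> k = k'.
  by move=> [p [q [px _ H]]] [p' [q' [px' _ H']]];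
    exact: (obox_overlap px px' H H').
have openC k : open [set x | C k x].
  have -> : [set x | C k x] = \bigcup_(z in [set z : R3 R * R3 R | cbox z.1 z.2
    `<=` Om /\
     \forall x \ae mu, obox z.1 z.2 x -> f x = k]) obox z.1 z.2.
    apply/seteqP; split => [x [p [q [px pO H]]]|x [[p q] [pO H] px]];
      first by exists (p, q).
    by exists p, q.
  by apply: bigcup_open => z _; exact: open_obox.
have [k0 Ck0] := ex _ Ox0.
have E : [set x | C k0 x] = Om.
  apply: cOm; first by exists x0.
    by exists [set x | C k0 x] => //; rewrite setIidr// => x /CO.
  (* [connected] also wants a closed set that cuts [C k0] out of [Om]: the complement of all the
     other classes. *)
  exists (~` \bigcup_(k in [set k | k != k0]) [set x | C k x]).
    by apply: open_closedC; apply: bigcup_open => k _; exact: openC.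
  apply/seteqP; split => [x Cx|x [Ox nC]].
    split; first exact: CO Cx.
    by move=> [k /= /eqP kk0 Ckx]; apply: kk0; exact: uC Ckx Cx.
  have [k Ckx] := ex _ Ox; have [<-//|kk0] := eqVneq k k0.
  by exfalso; apply: nC; exists k.
exists k0; apply: ae_from_boxes => // p q pqO.
have [k Hk] := zero_grad_box pqO.
have [[x px]|no] := pselect (obox p q !=set0); last first.
  by apply: aeW => x px; exfalso; apply: no; exists x.
suff <- : k = k0 by [].
apply: (uC _ _ x); first by exists p, q.
rewrite -/([set x | C k0 x] x) E; exact/pqO/obox_cbox.
Qed.

End ZeroGradient.

(** * Finite-dimensional damped systems *)

Section BilinearForms.
Variable R : realType.

Definition bil m k (G : 'I_m -> 'I_k -> R) (x : 'I_m -> R) (y : 'I_k -> R) : R :=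
  \sum_i \sum_j x i * y j * G i j.

Lemma bilDl m k (G : 'I_m -> 'I_k -> R) (c : R) x x' y :
  bil G (fun i => x i + c * x' i) y = bil G x y + c * bil G x' y.
Proof.
rewrite /bil mulr_sumr -big_split/=; apply: eq_bigr => i _.
by rewrite mulr_sumr -big_split/=; apply: eq_bigr => j _; ring.
Qed.

Lemma bil_tr m k (G : 'I_m -> 'I_k -> R) x y :
  bil G x y = bil (fun j i => G i j) y x.
Proof.
rewrite /bil exchange_big; apply: eq_bigr => i _; apply: eq_bigr => j _; ring.
Qed.

Lemma bilDr m k (G : 'I_m -> 'I_k -> R) (c : R) x y y' :
  bil G x (fun i => y i + c * y' i) = bil G x y + c * bil G x y'.
Proof. by rewrite bil_tr bilDl -!(bil_tr G). Qed.

Lemma bil0r m k (G : 'I_m -> 'I_k -> R) x : bil G x (fun=> 0) = 0.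
Proof. by rewrite /bil big1// => i _; rewrite big1// => j _;
  rewrite mulr0 mul0r. Qed.

Lemma is_derive_bil m k (G : 'I_m -> 'I_k -> R) (x : R -> 'I_m -> R)
    (y : R -> 'I_k -> R) (t : R) x' y' :
  (forall i, is_derive t 1 (fun s => x s i) (x' i)) ->
  (forall j, is_derive t 1 (fun s => y s j) (y' j)) ->
  is_derive t 1 (fun s => bil G (x s) (y s)) (bil G x' (y t) + bil G (x t) y').
Proof.
move=> dx dy.
pose h i j : R -> R := (fun s => x s i) * (fun s => y s j) * cst (G i j).
have E : (fun s => bil G (x s) (y s)) = \sum_i \sum_j h i j.
  apply/funext => s; rewrite fct_sumE; apply: eq_bigr => i _.
  by rewrite fct_sumE.
rewrite E.
have dh i j : is_derive t 1 (h i j) ((x' i * y t j + x t i * y' j) * G i j).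
  have := is_deriveM (is_deriveM (dx i) (dy j)) (is_derive_cst (G i j) t 1).
  by move=> H; apply: (is_derive_eq H); rewrite /GRing.scale/=; ring.
have : is_derive t 1 (\sum_i \sum_j h i j)
    (\sum_i \sum_j (x' i * y t j + x t i * y' j) * G i j).
  by apply: is_derive_sum => i; apply: is_derive_sum => j.
move=> H; apply: (is_derive_eq H); rewrite /bil -big_split/=; apply: eq_bigr => i _.
by rewrite -big_split/=; apply: eq_bigr => j _; rewrite mulrDl.
Qed.

Section PSD.
Variables (m : nat) (G : 'I_m -> 'I_m -> R).
Hypothesis symG : forall i j, G i j = G j i.
Hypothesis psdG : forall x, 0 <= bil G x x.

Lemma bilC x y : bil G x y = bil G y x.
Proof. by rewrite bil_tr; congr (bil _ _ _); apply/funext => i;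
  apply/funext => j. Qed.

Lemma bil_polar (c : R) x y :
  bil G (fun i => x i + c * y i) (fun i => x i + c * y i) =
  bil G x x + 2 * c * bil G x y + c ^+ 2 * bil G y y.
Proof. by rewrite bilDl !bilDr (bilC y x); ring. Qed.

Lemma bil_CS x y : bil G x y ^+ 2 <= bil G x x * bil G y y.
Proof.
have [y0|y0] := eqVneq (bil G y y) 0.
  have [->|xy0] := eqVneq (bil G x y) 0; first by rewrite expr0n/= mulr_ge0.
  (* When [y] is isotropic the form is affine along [y]; at this multiple it would take the value
     -1. *)
  have := psdG (fun i => x i + (- (bil G x x + 1) / (2 * bil G x y)) * y i).
  rewrite bil_polar y0 mulr0 addr0.
  rewrite (_ : 2 * _ * _ = - (bil G x x + 1)); last by field.
  by rewrite opprD addrA subrr add0r oppr_ge0 ler10.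
have yp : 0 < bil G y y by rewrite lt_def y0 psdG.
have := psdG (fun i => x i + (- bil G x y / bil G y y) * y i).
rewrite bil_polar => H; rewrite -ler_pdivrMr// -subr_ge0.
by apply: le_trans H _; rewrite le_eqVlt; apply/orP; left; apply/eqP; field.
Qed.

Hypothesis defG : forall x, bil G x x = 0 -> forall i, x i = 0.

(** The dual basis for the form, given by the rows of the inverse matrix. It serves to bound
    coordinates by the form and to solve a linear constraint for them. *)
Lemma bil_dual : exists y : 'I_m -> 'I_m -> R, forall x i, x i = bil G (y i) x.
Proof.
pose A : 'M[R]_m := \matrix_(i, j) G i j.
have uA : A \in unitmx.
  rewrite -row_free_unit; apply: inj_row_free => v vA.
  apply/matrixP => i j; rewrite ord1 mxE; apply: (defG (x := fun k => v 0 k)).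
  rewrite bil_tr /bil big1// => k _.
  under eq_bigr do rewrite -mulrA; rewrite -mulr_sumr.
  have /matrixP /(_ 0 k) := vA; rewrite !mxE => vAk.
  rewrite (_ : \sum_(l < m) _ = 0) ?mulr0// -[RHS]vAk.
  by apply: eq_bigr => l _; rewrite mxE.
exists (fun i k => invmx A i k) => x i.
have := mulmxA (invmx A) A (\col_k x k); rewrite mulVmx// mul1mx =>
  /matrixP /(_ i 0).
rewrite !mxE => <-; rewrite /bil; apply: eq_bigr => k _.
rewrite mxE mulr_sumr; apply: eq_bigr => j _; rewrite !mxE; ring.
Qed.

(** Cauchy-Schwarz against the dual vectors. The leading 1 keeps the constant positive even for
    [m = 0]. *)
Lemma bil_coercive : exists2 C, 0 < C & forall x i,
  `|x i| <= C * Num.sqrt (bil G x x).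
Proof.
have [y yP] := bil_dual.
exists (1 + \sum_i Num.sqrt (bil G (y i) (y i))).
  by rewrite ltr_pwDl// sumr_ge0// => i _; exact: sqrtr_ge0.
move=> x i; rewrite {1}(yP x i) -sqrtr_sqr.
apply: (@le_trans _ _ (Num.sqrt (bil G (y i) (y i)) * Num.sqrt (bil G x x))).
  by rewrite -sqrtrM//; apply: ler_wsqrtr; exact: bil_CS.
rewrite ler_wpM2r ?sqrtr_ge0// (bigD1 i)//= addrCA lerDl.
by rewrite addr_ge0// sumr_ge0// => j _; exact: sqrtr_ge0.
Qed.

End PSD.
End BilinearForms.

(** * Decay from a Lyapunov function *)

Section Lyapunov.
Variable R : realType.

Lemma nonincreasing_of_derive (V dV : R -> R) (t0 : R) :
  (forall t, t0 < t -> is_derive t 1 V (dV t)) -> (forall t, t0 < t -> dV t <= 0) ->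
  forall s t, t0 < s -> s <= t -> V t <= V s.
Proof.
move=> dV' dV0 s t ts st.
have D x : s <= x -> derivable V x 1 /\ derive1 V x <= 0.
  move=> sx; have tx := lt_le_trans ts sx.
  have [d dE] := dV' _ tx; split => //.
  by rewrite derive1E dE dV0.
apply: (@ler0_derive1_le_cc _ V s t); rewrite ?in_itv/= ?lexx ?st//.
- by move=> x; rewrite in_itv/= => /andP[/ltW sx _]; have [] := D x sx.
- by move=> x; rewrite in_itv/= => /andP[/ltW sx _]; have [] := D x sx.
- apply: derivable_within_continuous => x; rewrite in_itv/= => /andP[sx _].
  by have [] := D x sx.
Qed.

(** As [e] is nonincreasing, failing to tend to 0 would keep it above some [eps]. Then [V] would
    lose at least [eps] per unit of time and become negative. The limit of [V] is its infimum. *)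
Lemma lyapunov (e V de dV : R -> R) (t0 : R) :
  (forall t, t0 < t -> is_derive t 1 e (de t)) ->
  (forall t, t0 < t -> is_derive t 1 V (dV t)) ->
  (forall t, t0 < t -> 0 <= e t) -> (forall t, t0 < t -> 0 <= V t) ->
  (forall t, t0 < t -> de t <= 0) -> (forall t, t0 < t -> dV t <= - e t) ->
  (e t @[t --> +oo] --> (0 : R)) /\ (exists c : R, V t @[t --> +oo] --> c).
Proof.
move=> de' dV' e0 V0 dele dVle.
have ne := nonincreasing_of_derive de' dele.
have nV : forall s t, t0 < s -> s <= t -> V t <= V s.
  apply: nonincreasing_of_derive dV' _ => t tt.
  by rewrite (le_trans (dVle _ tt))// oppr_le0 e0.
split.
  apply/cvgrPdist_le => eps eps0.
  suff [s [ts es]] : exists s, t0 < s /\ e s <= eps.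
    exists s; split; first exact: num_real.
    move=> t /= st; have tt := lt_trans ts st.
    by rewrite sub0r normrN ger0_norm ?e0// (le_trans (ne _ _ ts (ltW st))).
  apply: contrapT => H.
  have He s : t0 < s -> eps < e s.
    by move=> ts; rewrite ltNge; apply/negP => es; apply: H; exists s.
  pose W t := V t + eps * t.
  have nW : forall s t, t0 < s -> s <= t -> W t <= W s.
    apply: (@nonincreasing_of_derive W (fun t => dV t + eps)) => t tt.
      have dVt := dV' _ tt.
      have H2 : is_derive t 1 (V + eps *: id) (dV t + eps *: (1 : R)) by exact:
        is_deriveD.
      by apply: (is_derive_eq H2); rewrite /GRing.scale/= mulr1.
    by have := dVle _ tt; have := He _ tt; lra.
  pose s := t0 + 1; have ts : t0 < s by rewrite ltrDl.
  (* Late enough for [W t <= W s] to force [V t <= -1]. *)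
  pose t := s + (V s + 1) / eps.
  have st : s <= t by rewrite lerDl divr_ge0 ?ltW// ltr_wpDl// V0.
  have := nW s t ts st; rewrite /W /t mulrDr mulrCA divff ?gt_eqF// mulr1.
  by have := V0 t (lt_le_trans ts st); rewrite /t; lra.
pose S := [set V s | s in [set s | t0 < s]].
have S0 : S !=set0 by exists (V (t0 + 1)), (t0 + 1) => //=; rewrite ltrDl.
have lS : lbound S 0 by move=> _ [s /= ts <-]; exact: V0.
have hS : has_inf S by split => //; exists 0.
exists (inf S); apply/cvgrPdist_lt => eps eps0.
have [_ [s /= ts <-] Vs] := inf_adherent eps0 hS.
exists s; split; first exact: num_real.
move=> t /= st; have tt := lt_trans ts st.
rewrite ler0_norm; last first.
  by rewrite subr_le0; apply: ge_inf; [exists 0|exists t].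
by rewrite opprB ltrBlDl; apply: le_lt_trans Vs; exact: nV _ _ ts (ltW st).
Qed.

End Lyapunov.

Section DampedSystem.
Variables (R : realType) (m k : nat).
Variables (M K : 'I_m -> 'I_m -> R) (N : 'I_k -> 'I_m -> R) (P : 'I_k -> 'I_k -> R).
Hypotheses (symM : forall i j, M i j = M j i) (symK : forall i j, K i j = K j i)
  (symP : forall i j, P i j = P j i).
Hypotheses (psdM : forall x, 0 <= bil M x x) (psdK : forall x, 0 <= bil K x x)
  (psdP : forall x, 0 <= bil P x x).
Hypothesis defP : forall x, bil P x x = 0 -> forall i, x i = 0.
Variables (rho alpha beta : R).
Hypotheses (rho0 : 0 < rho) (alpha0 : 0 < alpha) (beta0 : 0 < beta).
Variables (a a1 a2 : R -> 'I_m -> R) (b : R -> 'I_k -> R) (t0 : R).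
Hypothesis da : forall t, t0 < t -> forall i, is_derive t 1 (fun s =>
  a s i) (a1 t i).
Hypothesis da1 : forall t, t0 < t -> forall i, is_derive t 1 (fun s =>
  a1 s i) (a2 t i).
Hypothesis eq1 : forall t, t0 < t -> forall y,
  rho * bil M (a2 t) y + alpha * (rho * bil M (a1 t) y) + bil K (a t) y +
  beta * bil K (a1 t) y + bil N (b t) y = 0.
Hypothesis eq2 : forall t, t0 < t -> forall z, bil N z (a t) = bil P z (b t).

(** No derivative of [b] is given. The dual basis of [P] rewrites the constraint [eq2] as
    [b t j = bil N (y j) (a t)], so [b] inherits differentiability from [a]; uniqueness of
    derivatives then yields the differentiated constraint. *)
Lemma is_derive_slave : exists b1 : R -> 'I_k -> R,
  (forall t, t0 < t -> forall j, is_derive t 1 (fun s => b s j) (b1 t j)) /\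
  (forall t, t0 < t -> forall z, bil N z (a1 t) = bil P z (b1 t)).
Proof.
have [y yP] := bil_dual defP.
have dN t z : t0 < t -> is_derive t 1 (fun s => bil N z (a s)) (bil N z (a1 t)).
  move=> tt.
  have := @is_derive_bil R k m N (fun=> z) a t (fun=> 0) (a1 t)
    (fun i => is_derive_cst (z i) t 1) (da tt).
  by move=> H; apply: (is_derive_eq H); rewrite bil_tr bil0r add0r.
have db t : t0 < t -> forall j, is_derive t 1 (fun s => b s j) (bil N (y j) (a1 t)).
  move=> tt j; apply: near_eq_is_derive (dN t (y j) tt).
  near=> s; rewrite [RHS]yP eq2//; near: s; exact: lt_nbhsr.
exists (fun t j => bil N (y j) (a1 t)); split => // t tt z.
have H1 := dN t z tt.
have := @is_derive_bil R k k P (fun=> z) b t (fun=> 0) _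
    (fun i => is_derive_cst (z i) t 1) (db t tt).
rewrite bil_tr bil0r add0r => H2.
have H3 : is_derive t 1 (fun s => bil N z (a s)) (bil P z (fun j =>
  bil N (y j) (a1 t))).
  apply: near_eq_is_derive H2.
  near=> s; rewrite eq2//; near: s; exact: lt_nbhsr.
by case: H1 => _ <-; case: H3 => _ <-.
Unshelve. all: by end_near. Qed.

Lemma cvg0_le (f g : R -> R) : (\forall t \near +oo, 0 <= f t <= g t) ->
  g t @[t --> +oo] --> (0 : R) -> f t @[t --> +oo] --> (0 : R).
Proof.
by move=> fg g0; apply: (@squeeze_cvgr _ _ _ _ (cst 0) g) => //; exact: cvg_cst.
Qed.

Theorem damped_decay :
  [/\ bil M (a1 t) (a1 t) @[t --> +oo] --> (0 : R),
      bil K (a t) (a t) @[t --> +oo] --> (0 : R),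
      bil P (b t) (b t) @[t --> +oo] --> (0 : R) &
      exists c : R, bil M (a t) (a t) @[t --> +oo] --> c].
Proof.
have [b1 [db eqb]] := is_derive_slave.
pose Ma t := bil M (a t) (a t); pose Maa t := bil M (a1 t) (a t).
pose Ma1 t := bil M (a1 t) (a1 t).
pose Ka t := bil K (a t) (a t); pose Pb t := bil P (b t) (b t).
(* [E] is twice the mechanical and electric energy; the cross term in [V] makes
   its derivative at most [- E], although [E] does not control [a] along the
   kernel of [K]. *)
pose E t := rho * Ma1 t + Ka t + Pb t.
pose V t := alpha^-1 * E t + (rho * Maa t + alpha / 2 * rho * Ma t + beta / 2 *
  Ka t).
pose dE t := 2 * (rho * bil M (a2 t) (a1 t) + bil K (a1 t) (a t) + bil P (b1 t)
  (b t)).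
pose dV t := alpha^-1 * dE t + (rho * (bil M (a2 t) (a t) + Ma1 t) + alpha *
  rho * Maa t +
  beta * bil K (a1 t) (a t)).
have dquad n (G : 'I_n -> 'I_n -> R) (x : R -> 'I_n -> R) (x1 : 'I_n ->
  R) (t : R) : (forall i j, G i j = G j i) ->
    (forall i, is_derive t 1 (fun s : R => x s i) (x1 i)) ->
    is_derive t 1 (fun s => bil G (x s) (x s)) (2 * bil G x1 (x t)).
  move=> sG dx; have H := is_derive_bil G dx dx; apply: (is_derive_eq H).
  by rewrite (bilC sG (x t)); ring.
have dMa1 t (tt : t0 < t) : is_derive t 1 Ma1 (2 * bil M (a2 t) (a1 t)) :=
  dquad _ M _ _ _ symM (da1 tt).
have dMa t (tt : t0 < t) : is_derive t 1 Ma (2 * Maa t) := dquad _ M _ _ _ symM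
  (da tt).
have dKa t (tt : t0 < t) : is_derive t 1 Ka (2 * bil K (a1 t) (a t)) := dquad _
  K _ _ _ symK (da tt).
have dPb t (tt : t0 < t) : is_derive t 1 Pb (2 * bil P (b1 t) (b t)) := dquad _
  P _ _ _ symP (db _ tt).
have dMaa t (tt : t0 < t) : is_derive t 1 Maa (bil M (a2 t) (a t) + Ma1 t) :=
  is_derive_bil M (da1 tt) (da tt).
have dEt t : t0 < t -> is_derive t 1 E (dE t).
  move=> tt; have H := is_deriveD (is_deriveD (is_deriveZ rho (dMa1 t tt)) (dKa
    t tt)) (dPb t tt).
  by apply: (is_derive_eq H); rewrite /dE /GRing.scale/=; ring.
have dVt t : t0 < t -> is_derive t 1 V (dV t).
  move=> tt; have H := is_deriveD (is_deriveZ alpha^-1 (dEt t tt))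
   (is_deriveD (is_deriveD (is_deriveZ rho (dMaa t tt))
    (is_deriveZ (alpha / 2 * rho) (dMa t tt))) (is_deriveZ (beta / 2) (dKa t tt))).
  by apply: (is_derive_eq H); rewrite /dV /GRing.scale/=; field; rewrite gt_eqF.
have PN t : t0 < t -> bil P (b1 t) (b t) = bil N (b t) (a1 t).
  by move=> tt; rewrite (bilC symP) eqb.
have PN0 t : t0 < t -> Pb t = bil N (b t) (a t) by move=> tt; rewrite eq2.
(* The equation is tested with [a1 t]. By [PN] its coupling term is half the derivative of [Pb], so
   only the damping remains. *)
have dEE t : t0 < t -> dE t = - (2 * (alpha * rho * Ma1 t + beta * bil K (a1 t)
  (a1 t))).
  move=> tt; have := eq1 tt (a1 t); rewrite /dE PN// (bilC symK (a1 t) (a t)) /Ma1.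
  lra.
have dVE t : t0 < t -> dV t <= - E t.
  move=> tt; rewrite /dV dEE//; have := eq1 tt (a t).
  rewrite -PN0// -/(Ka t) -/(Maa t).
  have -> : alpha^-1 * - (2 * (alpha * rho * Ma1 t + beta * bil K (a1 t) (a1 t))) =
    - 2 * rho * Ma1 t - 2 * alpha^-1 * beta * bil K (a1 t) (a1 t) by field;
      rewrite gt_eqF.
  have : 0 <= 2 * alpha^-1 * beta * bil K (a1 t) (a1 t).
    by rewrite !mulr_ge0// ?invr_ge0 ltW.
  rewrite /E; lra.
have E0 t : 0 <= E t by rewrite !addr_ge0// ?psdK ?psdP// mulr_ge0 ?psdM// ltW.
(* Completing the square in [a1 + (alpha / 2) a] absorbs the cross term and uses up half of the [Ma]
   term of [V]; the other half bounds [Ma], which [E] cannot do. *)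
have Vlow t : rho * alpha / 4 * Ma t <= V t.
  have := psdM (fun i => a1 t i + alpha / 2 * a t i).
  rewrite (bil_polar symM) -/(Ma t) -/(Ma1 t) -/(Maa t) => H.
  have := psdK (a t); have := psdP (b t); rewrite -/(Pb t) -/(Ka t) => P0 K0.
  rewrite /V /E -subr_ge0.
  rewrite (_ : _ - _ = rho * alpha^-1 * (Ma1 t + 2 * (alpha / 2) * Maa t +
    (alpha / 2) ^+ 2 * Ma t)
     + alpha^-1 * Ka t + alpha^-1 * Pb t + beta / 2 * Ka t); last by field;
       rewrite gt_eqF.
  by rewrite !addr_ge0// !mulr_ge0// ?invr_ge0// ltW.
have Ma0 t : 0 <= Ma t by exact: psdM.
have V0 t : 0 <= V t.
  by apply: le_trans (Vlow t); rewrite !mulr_ge0// ?invr_ge0// ltW.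
have dE0 t : t0 < t -> dE t <= 0.
  move=> tt; rewrite dEE// oppr_le0 mulr_ge0// addr_ge0// mulr_ge0 ?psdM ?psdK
    ?mulr_ge0// ltW//.
have [limE [c limV]] := lyapunov dEt dVt (fun t _ => E0 t) (fun t _ =>
  V0 t) dE0 dVE.
have limMa1 : Ma1 t @[t --> +oo] --> (0 : R).
  apply: (@cvg0_le _ (fun t => rho^-1 * E t)).
    near=> t; rewrite psdM/= mulrC ler_pdivlMr// /E mulrC -addrA lerDl.
    by rewrite addr_ge0// ?psdK ?psdP.
  by rewrite -[X in _ --> X](mulr0 rho^-1); apply: cvgM => //; exact: cvg_cst.
have limKa : Ka t @[t --> +oo] --> (0 : R).
  apply: (@cvg0_le _ E) => //; near=> t; rewrite psdK/= /E addrAC lerDr.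
  by rewrite addr_ge0// ?psdP// mulr_ge0 ?psdM// ltW.
have limPb : Pb t @[t --> +oo] --> (0 : R).
  apply: (@cvg0_le _ E) => //; near=> t; rewrite psdP/= /E lerDr.
  by rewrite addr_ge0// ?psdK// mulr_ge0 ?psdM// ltW.
split => //.
(* Cauchy-Schwarz, with [Ma] eventually bounded through [Vlow] and [Ma1] tending to 0. *)
have limMaa : Maa t @[t --> +oo] --> (0 : R).
  pose B := (c + 1) / (rho * alpha / 4).
  have VB : \forall t \near +oo, Ma t <= B.
    have : \forall t \near +oo, V t < c + 1.
      by apply: (cvgr_lt c) => //; rewrite ltrDl.
    apply: filterS => t Vt; rewrite /B ler_pdivlMr; last by rewrite !mulr_gt0.
    by rewrite mulrC (le_trans (Vlow t))// ltW.
  apply/norm_cvg0P.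
  apply: (@cvg0_le _ (fun t => Num.sqrt (B * Ma1 t))).
    near=> t; rewrite normr_ge0/= -sqrtr_sqr ler_wsqrtr//.
    apply: le_trans (bil_CS symM psdM _ _) _; rewrite mulrC ler_wpM2r ?psdM//.
    by near: t.
  rewrite -[X in _ --> X]sqrtr0.
  apply: continuous_cvg; first exact: sqrt_continuous.
  by rewrite -[X in _ --> X](mulr0 B); apply: cvgM => //; exact: cvg_cst.
(* [Ma] is solved from the definition of [V], where its coefficient is [alpha / 2 * rho]; all the
   other terms tend to 0. *)
exists (c * (2 / (alpha * rho))).
rewrite (_ : (fun t => _) = (fun t => (V t - alpha^-1 * E t - rho * Maa t -
  beta / 2 * Ka t) *
  (2 / (alpha * rho)))); last first.
  by apply/funext => t; rewrite -/(Ma t) /V; field; rewrite !gt_eqF.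
apply: cvgM; last exact: cvg_cst.
rewrite -[X in _ --> X]subr0; apply: cvgB; last first.
  by rewrite -[X in _ --> X](mulr0 (beta / 2)); apply: cvgM => //; exact: cvg_cst.
rewrite -[X in _ --> X]subr0; apply: cvgB; last first.
  by rewrite -[X in _ --> X](mulr0 rho); apply: cvgM => //; exact: cvg_cst.
rewrite -[X in _ --> X]subr0; apply: cvgB => //.
by rewrite -[X in _ --> X](mulr0 alpha^-1); apply: cvgM => //; exact: cvg_cst.
Unshelve. all: by end_near. Qed.

End DampedSystem.

(** * Coercivity and traces *)

Section Coercivity.
Variable R : realType.

Lemma bil_dotv n (A : 'M[R]_n) (x : 'cV[R]_n) :
  bil (fun i j => A i j) (fun i => x i 0) (fun i => x i 0) = dotv x (A *m x).
Proof.
rewrite dotvE /bil; apply: eq_bigr => i _; rewrite mxE mulr_sumr.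
by apply: eq_bigr => j _; ring.
Qed.

(** Summing the squared coordinate bounds of [bil_coercive] gives the factor [n C^2]; the added 1
    keeps the denominator positive for [n = 0]. *)
Lemma sym_posdef_coercive n (A : 'M[R]_n) : sym_posdef A ->
  exists2 c, 0 < c & forall x, c * dotv x x <= dotv x (A *m x).
Proof.
move=> [sA pA].
have symA i j : A i j = A j i by rewrite -{1}sA mxE.
have ext (x : 'I_n -> R) : bil (fun i j => A i j) x x =
    dotv (\col_i x i) (A *m \col_i x i).
  by rewrite -bil_dotv; congr (bil _ _ _); apply/funext => i; rewrite mxE.
have psd x : 0 <= bil (fun i j => A i j) x x.
  rewrite ext; have [->|x0] := eqVneq (\col_i x i) 0; last exact/ltW/pA.
  by rewrite mulmx0 /dotv mulmx0 mxE.
have def x : bil (fun i j => A i j) x x = 0 -> forall i, x i = 0.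
  rewrite ext => H i; have [x0|x0] := eqVneq (\col_i x i) 0.
    by move/matrixP : x0 => /(_ i 0); rewrite !mxE.
  by have := pA _ x0; rewrite H ltxx.
have [C C0 HC] := bil_coercive symA psd def.
exists (n%:R * C ^+ 2 + 1)^-1.
  by rewrite invr_gt0 ltr_wpDl// mulr_ge0// sqr_ge0.
move=> x; rewrite mulrC ler_pdivrMr; last by rewrite ltr_wpDl// mulr_ge0// sqr_ge0.
have p0 : 0 <= dotv x (A *m x) by rewrite -bil_dotv.
rewrite mulrC mulrDl mul1r; apply: (@le_trans _ _ (n%:R * C ^+ 2 * dotv x (A *m
  x))); last by rewrite lerDl.
rewrite dotvE -mulrA.
apply: (@le_trans _ _ (\sum_(i < n) C ^+ 2 * dotv x (A *m x))).
  apply: ler_sum => i _; rewrite -expr2 -real_normK ?num_real//.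
  have := HC (fun i => x i 0) i; rewrite bil_dotv => H.
  rewrite -[X in _ * X](sqr_sqrtr p0) -exprMn; apply: lerXn2r => //; rewrite nnegrE.
  by rewrite mulr_ge0 ?sqrtr_ge0// ltW.
by rewrite sumr_const card_ord mulr_natl.
Qed.

Variable Om : set (R3 R).
Hypothesis mOm : measurable (Om : set (mR3 R)).

Lemma ipL2_app_adj p n (A : 'M[R]_(p, n)) f g :
  ipL2 Om (app_mx A f) g = ipL2 Om (app_mx A^T g) f.
Proof.
apply: eq_Rintegral => x _; rewrite dotvC /dotv /app_mx !trmx_mul trmxK.
by rewrite -mulmxA.
Qed.

Lemma ipL2_app_coercive n (A : 'M[R]_n) : sym_posdef A ->
  exists2 c, 0 < c & forall f, L2 Om f -> c * ipL2 Om f f <= ipL2 Om (app_mx A f) f.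
Proof.
move=> /sym_posdef_coercive[c c0 Hc]; exists c => // f Lf.
rewrite /ipL2 -RintegralZl//; last exact: L2_integrable_dotv.
apply: le_Rintegral => //.
- exact: (integrableZl mOm c (L2_integrable_dotv mOm Lf Lf)).
- by apply: L2_integrable_dotv => //; exact: L2_app_mx.
- by move=> x _; rewrite [leRHS]dotvC; exact: Hc.
Qed.

Lemma app_mx_comb p n m (A : 'M[R]_(p, n)) (x : 'I_m -> R) (F : 'I_m -> R3 R ->
  'cV[R]_n) f :
  ae_eqOm Om f (\sum_j x j *: F j) ->
  ae_eqOm Om (app_mx A f) (\sum_j x j *: app_mx A (F j)).
Proof.
apply: aeS => y fy Oy; rewrite /app_mx fy// !fct_sumE mulmx_sumr.
by apply: eq_bigr => j _; rewrite -scalemxAr.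
Qed.

Lemma vec1_comb m (x : 'I_m -> R) (w : 'I_m -> R3 R -> R) :
  vec1 (\sum_j x j *: w j) = \sum_j x j *: vec1 (w j).
Proof.
apply/funext => y; apply/matrixP => i j; rewrite !ord1 !fct_sumE /vec1 summxE
  mxE mulr1n.
by apply: eq_bigr => k _; rewrite !mxE mulr1n.
Qed.

Lemma vec1_ae f g : ae_eqOm Om f g -> ae_eqOm Om (vec1 f) (vec1 g).
Proof. by apply: aeS => y fg Oy; rewrite /vec1 fg. Qed.

Lemma bounded_leb3_fin : bounded_set Om -> (leb3 R Om < +oo)%E.
Proof.
move=> [M [_ HM]].
pose N := `|M| + 1.
have N0 : M < N by rewrite /N (le_lt_trans (ler_norm M))// ltrDl.
(* The max norm makes the ball a cube; the extra 1 provides the strict inequalities of an open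
   box. *)
have sub : Om `<=` obox (- (N + 1), - (N + 1), - (N + 1)) (N + 1, N + 1, N + 1).
  move=> x Ox; have := HM _ N0 x Ox; rewrite /= /Num.norm/= !ge_max.
  have H (t : R) : `|t| <= N -> - (N + 1) < t < N + 1.
    by rewrite -ltr_norml => /le_lt_trans; apply; rewrite ltrDl.
  by move=> /andP[/andP[/H a /H b] /H c]; split.
apply: le_lt_trans (leb3_obox_fin (- (N + 1), - (N + 1), - (N + 1)) (N + 1,
  N + 1, N + 1)).
apply: (@le_measure _ _ _ (leb3 R) (Om : set (mR3 R)) (obox _ _ : set (mR3
  R))); last exact: sub.
  by rewrite inE.
by rewrite inE; exact: measurable_obox.
Qed.

End Coercivity.

(** Passage from a time derivative in norm on [[0, oo)] to an ordinary derivative of one coordinate: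
    at [t > 0] the restriction [0 <= s] holds in a full neighbourhood. *)
Lemma is_derive_within (R : realType) (a N : R -> R) (d t C : R) : 0 < t ->
  N s @[s --> within [set s | 0 <= s /\ s != t] (nbhs t)] --> 0 ->
  (forall s, 0 <= s -> s != t -> `|(s - t)^-1 * (a s - a t) - d| <= C * N s) ->
  is_derive t 1 a d.
Proof.
move=> t0 N0 H.
have : h^-1 *: (a (h *: (1 : R) + t) - a t) @[h --> 0^'] --> d.
  have CN0 : C * N s @[s --> within [set s | 0 <= s /\ s != t] (nbhs t)] --> (0
    : R).
    by rewrite -[X in _ --> X](mulr0 C); apply: cvgM => //; exact: cvg_cst.
  apply/cvgrPdist_le => e e0.
  have /cvgrPdist_le /(_ e e0) := CN0; rewrite near_withinE => Hn.
  have sh : h + t @[h --> (0 : R)] --> t.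
    by rewrite -[X in _ --> X]add0r; apply: cvgD; [exact: cvg_id|exact: cvg_cst].
  have t0' : \forall s \near t, 0 <= s by near=> s; rewrite ltW//; near: s;
    exact: lt_nbhsr.
  rewrite near_withinE; near=> h => h0.
  have : [set s | 0 <= s /\ s != t -> `|0 - C * N s| <= e] (h + t).
    by near: h; exact: sh _ Hn.
  have ht0 : 0 <= h + t by near: h; exact: sh _ t0'.
  have htt : h + t != t by rewrite -subr_eq0 addrK.
  move=> /(_ (conj ht0 htt)); rewrite sub0r normrN => HN.
  have := H _ ht0 htt; rewrite addrK => H'.
  rewrite distrC /GRing.scale/= mulr1 (le_trans H')// (le_trans _ HN)//.
  exact: ler_norm.
by move=> dc; apply: DeriveDef; [apply/cvg_ex; exists d|exact/cvg_lim].
Unshelve. all: by end_near. Qed.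

(** * Traces and constant functions *)

Section Trace.
Variables (R : realType) (Om : set (R3 R)).
Hypothesis oOm : open Om.
Hypothesis fOm : (leb3 R Om < +oo)%E.
Let mOm : measurable (Om : set (mR3 R)) := open_measurable3 oOm.
Variable tr : (R3 R -> R) -> R3 R -> R.
Hypothesis htr : trace_operator Om tr.

Lemma ae_onS2 (S : set (R3 R)) (f g h f' g' h' : R3 R -> R) :
  (forall x, f x = g x -> f' x = g' x -> h x = h' x) ->
  ae_on S f g -> ae_on S f' g' -> ae_on S h h'.
Proof. by move=> H; apply: aeS2 => x fg fg' Sx; apply: H;
  [exact: fg|exact: fg']. Qed.

Lemma H1_0 : H1 Om (0 : R3 R -> R).
Proof.
have E : vec1 (0 : R3 R -> R) = 0.
  by apply/funext => x; apply/matrixP => i j; rewrite !mxE mul0rn.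
split; first by rewrite E; exact: L2_0.
by exists 0; split; [exact: L2_0|rewrite E; exact: weak_image0].
Qed.

Lemma H1_lin (a : R) f g : H1 Om f -> H1 Om g -> H1 Om (a *: f + g).
Proof.
move=> [Lf [df [Ldf Wf]]] [Lg [dg [Ldg Wg]]].
have E : vec1 (a *: f + g) = a *: vec1 f + vec1 g.
  by apply/funext => x; apply/matrixP => i j; rewrite !mxE mulrnDl -mulrnAr.
have LZ : L2 Om (a *: vec1 f) by exact: L2Z.
have LZd : L2 Om (a *: df) by exact: L2Z.
split; first by rewrite E; exact: L2D.
exists (a *: df + dg); split; first exact: L2D.
rewrite E; apply: weak_imageD => //; first exact: linear_grad.
by apply: weak_imageZ => //; exact: linear_grad.
Qed.

Lemma H10_0 : H10 Om tr (0 : R3 R -> R).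
Proof.
split; first exact: H1_0.
(* Linearity at [-1 *: 0 + 0] equates [tr 0] with [- tr 0 + tr 0] almost everywhere. *)
have [_ /(_ (-1) 0 0 H1_0 H1_0) + _ _] := htr.
rewrite scaler0 addr0; apply: aeS => x /[apply] ->.
by rewrite -[LHS]/(-1 * tr 0 x + tr 0 x) mulN1r addNr.
Qed.

Lemma H10_lin (a : R) f g : H10 Om tr f -> H10 Om tr g -> H10 Om tr (a *: f + g).
Proof.
move=> [Hf tf] [Hg tg]; split; first exact: H1_lin.
have [_ /(_ a f g Hf Hg) T _ _] := htr.
have : ae_on (Gam Om) (a *: tr f + tr g) (cst 0).
  apply: ae_onS2 tf tg => x /= fx gx.
  by rewrite -[LHS]/(a * tr f x + tr g x) fx gx mulr0 addr0.
by apply: ae_onS2 T => x -> ->.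
Qed.

Lemma H10_comb m (x : 'I_m -> R) (w : 'I_m -> R3 R -> R) :
  (forall j, H10 Om tr (w j)) -> H10 Om tr (\sum_j x j *: w j).
Proof.
move=> Hw; elim: (index_enum _) => [|j s ih]; first by rewrite big_nil;
  exact: H10_0.
by rewrite big_cons; exact: H10_lin.
Qed.

(** The zero field is a distributional gradient of [f], so by uniqueness the one selected by [gradw]
    is null as well. *)
Lemma nH1_ae0 f : ae_eqOm Om f 0 -> nH1 Om f = 0.
Proof.
move=> f0; have v0 : ae_eqOm Om (vec1 f) 0.
  by apply: aeS f0 => x fx Ox; apply/matrixP => i j; rewrite /vec1 fx// !mxE mul0rn.
have W : weak_image Om (@grad_symbol R) (vec1 f) 0.
  apply: (@weak_image_ae _ _ _ _ _ 0 _ 0); last exact: weak_image0.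
    by apply: aeS v0 => x vx Ox; rewrite vx.
  exact: aeW.
have [_ _ g0] := wopP oOm fOm (L2_0 mOm 3) W.
have E1 : ipL2 Om (vec1 f) (vec1 f) = 0 by rewrite (ipL2_ae v0 v0) ipL2_0l.
have E2 : ipL2 Om (gradw Om f) (gradw Om f) = 0 by rewrite (ipL2_ae g0 g0) ipL2_0l.
rewrite /nH1 /nHop /ipHop E1 -/(gradw Om f).
by rewrite E2 addr0 sqrtr0.
Qed.

(* [Gam] is not known to be measurable here, whence the detour through [S]. *)
Lemma nL2surf_gt0 (S : set (R3 R)) (g : R3 R -> R) (k : R) :
  S `<=` Gam Om -> has_area S -> k != 0 -> L2surf Om g ->
  ae_on (Gam Om) g (cst k) -> 0 < nL2surf Om g.
Proof.
move=> SG [mS S0] k0 [_ g2] gk.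
rewrite sqrtr_gt0 /Rintegral; apply: fine_gt0; rewrite g2 andbT.
apply: (@lt_le_trans _ _ (\int[surf R]_(x in Gam Om) ((cst (k ^+ 2)%:E) \_ S)
  x)%E); last first.
  apply: ae_ge0_le_integral => [x _|x _|].
  - by rewrite /patch; case: ifP => // _; rewrite lee_fin sqr_ge0.
  - by rewrite lee_fin sqr_ge0.
  apply: aeS gk => x gx Gx; rewrite /patch; case: ifP => // _;
    rewrite ?lee_fin ?sqr_ge0//.
  by rewrite gx.
rewrite -integral_mkcondr (setIidr SG) integral_cst//.
by rewrite mule_gt0// lte_fin exprn_even_gt0.
Qed.

(** [tr] acts on functions, not on classes, so [f = k] almost everywhere does not speak of [tr f]
    directly. Boundedness is the link: [f - k] has norm 0, hence so has its trace, which equals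
    [- k] almost everywhere on the boundary. *)
Lemma H10_const0 f (k : R) (S : set (R3 R)) :
  S `<=` Gam Om -> has_area S -> H10 Om tr f ->
  weak_image Om (@grad_symbol R) (vec1 f) 0 -> ae_eqOm Om f (cst k) -> k = 0.
Proof.
move=> SG aS [Hf tf] W fk; apply/eqP; apply: contraT => k0.
(* [cst k] inherits its zero gradient from [f]; no integration by parts. *)
have Hk : H1 Om (cst k).
  split; first by apply/L2P => // i; have := sqint_cst mOm fOm k;
    congr (sqint _ _ _); apply/funext => x; rewrite /vec1 mxE ord1 mulr1n.
  exists 0; split; first exact: L2_0.
  by apply: weak_image_ae W; [exact: vec1_ae|exact: aeW].
have [T1 T2 [C T3] T4] := htr.
have Hh : H1 Om ((-1) *: cst k + f) by exact: H1_lin.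
have h0 : nH1 Om ((-1) *: cst k + f) = 0.
  apply: nH1_ae0; apply: aeS fk => x fx Ox; rewrite -[LHS]/(-1 * k + f x) fx//.
  by rewrite mulN1r addNr.
have th : ae_on (Gam Om) (tr ((-1) *: cst k + f)) (cst (- k)).
  have tk : ae_on (Gam Om) (tr (cst k)) (cst k).
    by apply: T4 => //; exact: cst_continuous.
  have : ae_on (Gam Om) ((-1) *: tr (cst k) + tr f) (cst (- k)).
    apply: ae_onS2 tk tf => x /= kx fx.
    by rewrite -[LHS]/(-1 * tr (cst k) x + tr f x) kx fx mulN1r addr0.
  by apply: ae_onS2 (T2 (-1) _ _ Hk Hf) => x -> ->.
have nk0 : - k != 0 by rewrite oppr_eq0.
have := nL2surf_gt0 SG aS nk0 (T1 _ Hh) th.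
by move=> /lt_le_trans /(_ (T3 _ Hh)); rewrite h0 mulr0 ltxx.
Qed.

End Trace.

(** * The Galerkin approximation *)

Lemma cvg0_sum (R : realType) (I : finType) (f : I -> R -> R) :
  (forall i, f i t @[t --> +oo] --> (0 : R)) ->
  \sum_i f i t @[t --> +oo] --> (0 : R).
Proof.
move=> f0; elim: (index_enum I) => [|i s ih].
  by under eq_fun do rewrite big_nil; exact: cvg_cst.
rewrite (_ : (fun t => _) = (fun t => f i t + \sum_(j <- s) f j t)).
  by rewrite -[X in _ --> X]addr0; apply: cvgD; [exact: f0|exact: ih].
by apply/funext => t; rewrite big_cons.
Qed.

Section Assembly.
Variables (R : realType) (Om : set (R3 R)).
Hypothesis oOm : open Om.
Hypothesis fOm : (leb3 R Om < +oo)%E.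
Let mOm : measurable (Om : set (mR3 R)) := open_measurable3 oOm.

(** The coordinates are chosen separately at each time; their regularity in time has to be recovered
    afterwards. *)
Lemma spanm_coords (V : lmodType R) (v : nat -> R3 R -> V) m (u : R -> R3 R -> V) :
  (forall t, 0 <= t -> spanm Om v m (u t)) ->
  exists a : R -> 'I_m -> R, forall t, 0 <= t ->
    ae_eqOm Om (u t) (\sum_(j < m) a t j *: v j).
Proof.
move=> H.
have /choice[a Ha] : forall t, exists c : 'I_m -> R, 0 <= t ->
    ae_eqOm Om (u t) (\sum_(j < m) c j *: v j).
  move=> t; have [t0|_] := leP 0 t; last by exists (fun=> 0).
  by have [c Hc] := H t t0; exists c.
by exists a.
Qed.

Lemma spanm_ae (V : lmodType R) (v : nat -> R3 R -> V) m (x : 'I_m -> R) :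
  spanm Om v m (\sum_(j < m) x j *: v j).
Proof. by exists x; exact: aeW. Qed.

Definition gram n m k (F : 'I_m -> R3 R -> 'cV[R]_n) (G : 'I_k -> R3 R ->
  'cV[R]_n) :=
  fun i j => ipL2 Om (F i) (G j).

Lemma ipL2_gram n m k (F : 'I_m -> R3 R -> 'cV[R]_n) (G : 'I_k -> R3 R -> 'cV[R]_n)
    x y f g : (forall j, L2 Om (F j)) -> (forall j, L2 Om (G j)) ->
  ae_eqOm Om f (\sum_j x j *: F j) -> ae_eqOm Om g (\sum_j y j *: G j) ->
  ipL2 Om f g = bil (gram F G) x y.
Proof. exact: ipL2_comb. Qed.

(** The hypothesis that [N] dominates every coordinate is applied to the difference quotient minus
    the derivative, whose coordinates are the corresponding scalar expressions. *)
Lemma time_derivative_coords n m (N : (R3 R -> 'cV[R]_n) -> R) (v : nat ->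
  R3 R -> 'cV[R]_n)
    (u du : R -> R3 R -> 'cV[R]_n) (a a1 : R -> 'I_m -> R) (C t : R) :
  (forall x f, ae_eqOm Om f (\sum_(j < m) x j *: v j) ->
    forall j, `|x j| <= C * N f) ->
  time_derivative N u du ->
  (forall t, 0 <= t -> ae_eqOm Om (u t) (\sum_(j < m) a t j *: v j)) ->
  (forall t, 0 <= t -> ae_eqOm Om (du t) (\sum_(j < m) a1 t j *: v j)) ->
  0 < t -> forall j, is_derive t 1 (fun s => a s j) (a1 t j).
Proof.
move=> HN ud ua da t0 j.
apply: (is_derive_within t0 (ud t (ltW t0))) => s s0 st.
apply: (HN (fun j => (s - t)^-1 * (a s j - a t j) - a1 t j)).
have us := ua s s0; have ut := ua t (ltW t0); have dt := da t (ltW t0).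
have : \forall x \ae leb3 R, Om x -> u s x = (\sum_(j < m) a s j *: v j) x /\
    u t x = (\sum_(j < m) a t j *: v j) x.
  by apply: aeS2 us ut => x usx utx Ox; split; [exact: usx|exact: utx].
move=> ust; apply: aeS2 ust dt => x ustx dx Ox.
have [sx tx] := ustx Ox.
rewrite -[LHS]/((s - t)^-1 *: (u s x - u t x) - du t x) sx tx (dx Ox) !fct_sumE.
rewrite -sumrB scaler_sumr -sumrB; apply: eq_bigr => k _.
rewrite -[(a s k *: v k) x]/(a s k *: v k x) -[(a t k *: v k) x]/(a t k *: v k x).
rewrite -[(a1 t k *: v k) x]/(a1 t k *: v k x) -[RHS]/(_ *: v k x).
by rewrite -scalerBl scalerA -scalerBl.
Qed.

End Assembly.

Theorem corollary11 (R : realType)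
    (Om : set (R3 R)) (hOm : bounded_domain Om)
    (tr : (R3 R -> R) -> R3 R -> R) (htr : trace_operator Om tr)
    (Ge Gg Gr : set (R3 R)) (hGam : boundary_partition Om Ge Gg Gr)
    (chi : R3 R -> R) (hchi : H1 Om chi)
    (hchig : ae_on Gg (tr chi) (cst 0)) (hchie : ae_on Ge (tr chi) (cst 1))
    (c11 c12 c13 c33 c44 eps11 eps33 e15 e13 e33 : R)
    (hcE : sym_posdef (elast_mx c11 c12 c13 c33 c44))
    (hepsS : sym_posdef (permit_mx eps11 eps33))
    (rho alpha beta : R) (hrho : 0 < rho) (halpha : 0 < alpha) (hbeta : 0 < beta)
    (u_0 u_1 : R3 R -> 'cV[R]_3) (hu_0 : H1B Om u_0) (hu_1 : L2 Om u_1)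
    (phie : R -> R)
    (hphie : forall T : R, 0 < T -> H1_time_H12 Om tr Ge T phie)
    (t0 : R) (ht0 : 0 <= t0) (hphie0 : forall t, t0 <= t -> phie t = 0)
    (v : nat -> R3 R -> 'cV[R]_3)
    (hv : galerkin_family Om (H1B Om) (nH1B Om) v)
    (w : nat -> R3 R -> R)
    (hw : galerkin_family Om (H10 Om tr) (nH1 Om) w)
    (m : nat)
    (u du ddu : R -> R3 R -> 'cV[R]_3) (phi : R -> R3 R -> R)
    (hsol : galerkin_approx Om (elast_mx c11 c12 c13 c33 c44)
       (piezo_mx e15 e13 e33) (permit_mx eps11 eps33) rho alpha beta
       u_0 u_1 chi phie v w m u du ddu phi) :
  [/\ nL2 Om (du t) @[t --> +oo] --> 0,
      nL2 Om (Bw Om (u t)) @[t --> +oo] --> 0,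
      nH1 Om (phi t) @[t --> +oo] --> 0
    & exists2 c : R, 0 <= c &
        nL2 Om (du t) ^+ 2 + nH1B Om (u t) ^+ 2 + nH1 Om (phi t) ^+ 2
          @[t --> +oo] --> c].
Proof.
have [_ oOm cOm bOm] := hOm.
have mOm : measurable (Om : set (mR3 R)) := open_measurable3 oOm.
have fOm := bounded_leb3_fin mOm bOm.
have [Hv indv _] := hv; have [Hw indw _] := hw.
have [[uC duC dduC ud dud] [phiX _] heq _ _] := hsol.
have [a Ha] := spanm_coords uC.1.
have [a1 Ha1] := spanm_coords duC.1.
have [a2 Ha2] := spanm_coords dduC.1.
have [b Hb] := spanm_coords phiX.
set cE := elast_mx _ _ _ _ _ in hcE heq *.
set epsS := permit_mx _ _ in hepsS heq *.
set e := piezo_mx _ _ _ in heq *.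
pose F (j : 'I_m) := v j.
pose BF (j : 'I_m) := Bw Om (v j).
pose W (j : 'I_m) := vec1 (w j).
pose DW (j : 'I_m) := gradw Om (w j).
have LF j : L2 Om (F j) by case: (Hv j).
have LBF j : L2 Om (BF j) := (Hop_wop oOm fOm (Hv j)).1.
have H1w (j : 'I_m) : H1 Om (w j) by case: (Hw j).
have LW j : L2 Om (W j) by case: (H1w j).
have LDW j : L2 Om (DW j) := (Hop_wop oOm fOm (H1w j)).1.
have LcB j : L2 Om (app_mx cE (BF j)) := L2_app_mx mOm cE (LBF j).
have LeD j : L2 Om (app_mx e^T (DW j)) := L2_app_mx mOm e^T (LDW j).
have LeB j : L2 Om (app_mx e (BF j)) := L2_app_mx mOm e (LBF j).
have LpD j : L2 Om (app_mx epsS (DW j)) := L2_app_mx mOm epsS (LDW j).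
have BwC x f : ae_eqOm Om f (\sum_j x j *: F j) ->
  ae_eqOm Om (Bw Om f) (\sum_j x j *: BF j).
  by move=> fx; apply: (wop_comb oOm fOm (@linear_voigt R) (fun j => Hv j) fx).
have vecC x f : ae_eqOm Om f (\sum_j x j *: w (j : 'I_m)) ->
  ae_eqOm Om (vec1 f) (\sum_j x j *: W j).
  by move=> fx; rewrite /W -vec1_comb; exact: vec1_ae.
have gradC x f : ae_eqOm Om f (\sum_j x j *: w (j : 'I_m)) ->
  ae_eqOm Om (gradw Om f) (\sum_j x j *: DW j).
  by move=> /vecC fx; apply: (wop_comb oOm fOm (@linear_grad R) (fun j =>
    H1w j) fx).
(* [M], [K], [N], [P] are the mass, stiffness, coupling and permittivity matrices; [KB], [G] and [Q]
   carry no material weight and express the norms. *)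
pose M := gram Om F F; pose KB := gram Om BF BF.
pose K := gram Om (fun j => app_mx cE (BF j)) BF.
pose N := gram Om (fun j => app_mx e^T (DW j)) BF.
pose P := gram Om (fun j => app_mx epsS (DW j)) DW.
pose G := gram Om DW DW; pose Q := gram Om W W.
have refl n (f : R3 R -> 'cV[R]_n) : ae_eqOm Om f f by exact: aeW.
have bilE n k l (X : 'I_k -> R3 R -> 'cV[R]_n) (Y : 'I_l -> R3 R -> 'cV[R]_n) x y :
    (forall j, L2 Om (X j)) -> (forall j, L2 Om (Y j)) ->
    bil (gram Om X Y) x y = ipL2 Om (\sum_j x j *: X j) (\sum_j y j *: Y j).
  by move=> LX LY; rewrite (ipL2_gram oOm LX LY (refl _ _) (refl _ _)).
have appC n k p (A : 'M[R]_(p, n)) (X : 'I_k -> R3 R -> 'cV[R]_n) x :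
    ae_eqOm Om (app_mx A (\sum_j x j *: X j)) (\sum_j x j *: app_mx A (X j)).
  by apply: app_mx_comb; exact: refl.
have psd n k (X : 'I_k -> R3 R -> 'cV[R]_n) x : (forall j, L2 Om (X j)) ->
    0 <= bil (gram Om X X) x x.
  by move=> LX; rewrite bilE//; exact: ipL2_ge0.
have coer n k (A : 'M[R]_n) (X : 'I_k -> R3 R ->
  'cV[R]_n) : (forall j, L2 Om (X j)) ->
    sym_posdef A -> exists2 c, 0 < c & forall x, c * bil (gram Om X X) x x <=
      bil (gram Om (fun j => app_mx A (X j)) X) x x.
  move=> LX /(ipL2_app_coercive mOm)[c c0 Hc]; exists c => // x.
  have LA j := L2_app_mx mOm A (LX j).
  rewrite !bilE// -(ipL2_ae (appC _ _ _ A X x) (refl _ _)).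
  by apply: Hc; exact: L2_comb.
have [cK cK0 HK] := coer _ _ cE BF LBF hcE.
have [cP cP0 HP] := coer _ _ epsS DW LDW hepsS.
have gsym n k (X : 'I_k -> R3 R -> 'cV[R]_n) i j : gram Om X X i j = gram Om X
  X j i.
  exact: ipL2C.
have asym n k (A : 'M[R]_n) (X : 'I_k -> R3 R -> 'cV[R]_n) i j : A^T = A ->
   gram Om (fun j => app_mx A (X j)) X i j = gram Om (fun j =>
     app_mx A (X j)) X j i.
  by move=> AT; rewrite /gram ipL2_app_adj AT.
have symM i j : M i j = M j i by exact: gsym.
have symK i j : K i j = K j i by apply: asym; case: hcE.
have symP i j : P i j = P j i by apply: asym; case: hepsS.
have psdM x : 0 <= bil M x x by exact: psd.
have psdK x : 0 <= bil K x x by apply: le_trans (HK x); rewrite mulr_ge0 ?psd// ltW.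
have psdP x : 0 <= bil P x x by apply: le_trans (HP x); rewrite mulr_ge0 ?psd// ltW.
have defM x : bil M x x = 0 -> forall i, x i = 0.
  rewrite bilE// => /(ipL2_eq0 mOm (L2_comb mOm x LF)) H.
  exact: indv H.
have defP x : bil P x x = 0 -> forall i, x i = 0.
  move=> H; pose f := \sum_(j < m) x j *: w j.
  have Hf : H10 Om tr f by apply: H10_comb => // j; exact: Hw.
  have G0 : bil G x x = 0.
    apply/eqP; rewrite eq_le psd// andbT -(pmulr_rle0 _ cP0).
    by apply: le_trans (HP x) _; rewrite -/P H.
  have g0 : ae_eqOm Om (gradw Om f) 0.
    have := G0; rewrite bilE// => /(ipL2_eq0 mOm (L2_comb mOm x LDW)) S0.
    have S1 := gradC x f (aeW _ (fun _ _ => erefl)).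
    by apply: aeS2 S1 S0 => y fy gy Oy; rewrite fy// gy.
  have wf : weak_image Om (@grad_symbol R) (vec1 f) 0.
    apply: weak_image_ae (Hop_wop oOm fOm Hf.1).2; last exact: g0.
    exact: refl.
  have sf : sqint (leb3 R) (Om : set (mR3 R)) f.
    have := (L2P mOm _).1 Hf.1.1 0; congr (sqint _ _ _); apply/funext => y.
    by rewrite /vec1 mxE mulr1n.
  have [k Hk] := zero_grad_const oOm fOm sf wf cOm.
  have [[GeG _ _ _] [[_ aGe] _ _]] := hGam.
  have k0 := H10_const0 oOm fOm htr GeG aGe Hf wf Hk.
  by apply: indw; rewrite -/f; apply: aeS Hk => y /[apply] ->; rewrite k0.
have [CM CM0 HCM] := bil_coercive symM psdM defM.
have [CP CP0 HCP] := bil_coercive symP psdP defP.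
have nH1BE x f : ae_eqOm Om f (\sum_j x j *: F j) ->
    nH1B Om f = Num.sqrt (bil M x x + bil KB x x).
  move=> fx; rewrite /nH1B /nHop /ipHop -/(Bw Om f).
  by rewrite (ipL2_gram oOm LF LF fx fx) (ipL2_gram oOm LBF LBF (BwC _ _ fx)
    (BwC _ _ fx)).
have nH1E x f : ae_eqOm Om f (\sum_j x j *: w (j : 'I_m)) ->
    nH1 Om f = Num.sqrt (bil Q x x + bil G x x).
  move=> fx; rewrite /nH1 /nHop /ipHop -/(gradw Om f).
  by rewrite (ipL2_gram oOm LW LW (vecC _ _ fx) (vecC _ _ fx))
    (ipL2_gram oOm LDW LDW (gradC _ _ fx) (gradC _ _ fx)).
have HN x f : ae_eqOm Om f (\sum_(j < m) x j *: v j) ->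
  forall j, `|x j| <= CM * nH1B Om f.
  move=> fx j; rewrite (nH1BE _ _ fx); apply: le_trans (HCM x j) _.
  by apply: ler_wpM2l; [exact: ltW|apply: ler_wsqrtr; rewrite lerDl psd].
have pos t : t0 < t -> 0 < t by exact: le_lt_trans.
have da t (tt : t0 < t) := time_derivative_coords HN ud Ha Ha1 (pos t tt).
have da1 t (tt : t0 < t) := time_derivative_coords HN dud Ha1 Ha2 (pos t tt).
have eqn t (tt : t0 < t) x z :
    rho * bil M (a2 t) x + alpha * (rho * bil M (a1 t) x) + bil K (a t) x +
    beta * bil K (a1 t) x + bil N (b t) x + bil N z (a t) - bil P (b t) z = 0.
  have t00 : 0 <= t := ltW (pos t tt).
  have := heq t t00 _ _ (spanm_ae Om v x) (spanm_ae Om w z).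
  rewrite hphie0 ?ltW// oppr0 !mul0r addr0.
  set f := \sum_(j < m) _; set g := \sum_(j < m) _.
  have fx : ae_eqOm Om f (\sum_j x j *: F j) by exact: aeW.
  have gz : ae_eqOm Om g (\sum_j z j *: w (j : 'I_m)) by exact: aeW.
  have rhoE (d : R -> R3 R -> 'cV[R]_3) (c : R -> 'I_m -> R) :
      ae_eqOm Om (d t) (\sum_j c t j *: F j) ->
      ipL2 Om (rho *: d t) f = rho * bil M (c t) x.
    move=> dc; have dc' : ae_eqOm Om (rho *: d t) (rho *: \sum_j c t j *: F j).
      apply: aeS dc => y dy Oy; rewrite -[LHS]/(rho *: d t y) dy//.
    rewrite (ipL2_ae dc' fx) ipL2Zl//; [|exact: L2_comb|exact: L2_comb].
    by rewrite -bilE.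
  rewrite (rhoE ddu a2 (Ha2 t t00)) (rhoE du a1 (Ha1 t t00)).
  have BE := BwC _ _ (Ha t t00). have B1E := BwC _ _ (Ha1 t t00).
  have DE := gradC _ _ (Hb t t00). have BfE := BwC _ _ fx. have DgE := gradC _ _ gz.
  rewrite (ipL2_gram oOm LcB LBF (app_mx_comb cE BE) BfE).
  rewrite (ipL2_gram oOm LcB LBF (app_mx_comb cE B1E) BfE).
  rewrite (ipL2_gram oOm LeD LBF (app_mx_comb e^T DE) BfE).
  (* By adjointness both coupling terms involve the same matrix [N], on which the energy balance
     rests. *)
  rewrite [ipL2 Om (app_mx e _) _]ipL2_app_adj.
  rewrite (ipL2_gram oOm LeD LBF (app_mx_comb e^T DgE) BE).
  by rewrite (ipL2_gram oOm LpD LDW (app_mx_comb epsS DE) DgE).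
have bil0l n k (X : 'I_n -> 'I_k -> R) x : bil X (fun=> 0) x = 0.
  by rewrite bil_tr bil0r.
(* The two test functions vary independently; setting either to 0 splits the system into the
   equation of motion and the static constraint. *)
have eq1 t (tt : t0 < t) x : rho * bil M (a2 t) x + alpha * (rho * bil M (a1 t) x) +
    bil K (a t) x + beta * bil K (a1 t) x + bil N (b t) x = 0.
  by have := eqn t tt x (fun=> 0); rewrite bil0l bil0r addr0 subr0.
have eq2 t (tt : t0 < t) z : bil N z (a t) = bil P z (b t).
  have := eqn t tt (fun=> 0) z; rewrite !bil0r !mulr0 !addr0 !add0r (bilC symP)
    => /eqP.
  by rewrite subr_eq0 => /eqP.
have [limM1 limK limP [c limM]] := damped_decay symM symK symP psdM psdK psdP defP
  hrho halpha hbeta da da1 eq1 eq2.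
(* The expansions in the bases are available for [0 <= t] only. *)
have near0 : \forall t \near +oo, 0 <= (t : R) by exists 0; split;
  [exact: num_real|move=> t /ltW].
have cvg0M (f : R -> R) (k : R) : f t @[t --> +oo] --> (0 : R) ->
  k * f t @[t --> +oo] --> (0 : R).
  by move=> f0; rewrite -[X in _ --> X](mulr0 k); apply: cvgM => //; exact: cvg_cst.
have limKB : bil KB (a t) (a t) @[t --> +oo] --> (0 : R).
  apply: cvg0_le (cvg0M _ cK^-1 limK); near=> t.
  by rewrite psd//= mulrC ler_pdivlMr// mulrC HK.
have limG : bil G (b t) (b t) @[t --> +oo] --> (0 : R).
  apply: cvg0_le (cvg0M _ cP^-1 limP); near=> t.
  by rewrite psd//= mulrC ler_pdivlMr// mulrC HP.
have sqrt0 (f : R -> R) : f t @[t --> +oo] --> (0 : R) ->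
  Num.sqrt (f t) @[t --> +oo] --> (0 : R).
  move=> f0; rewrite -[X in _ --> X]sqrtr0.
  by apply: continuous_cvg => //; exact: sqrt_continuous.
(* Finite dimension stands in for the Poincare inequality: [P] controls the coordinates of [phi],
   hence also the [L2] part [Q] of its norm. *)
have limb j : b t j @[t --> +oo] --> (0 : R).
  apply/norm_cvg0P; apply: cvg0_le (cvg0M _ CP (sqrt0 _ limP)); near=> t.
  by rewrite normr_ge0 HCP.
have limQ : bil Q (b t) (b t) @[t --> +oo] --> (0 : R).
  apply: cvg0_sum => i; apply: cvg0_sum => j.
  under eq_fun do rewrite mulrC.
  apply: (cvg0M (fun t => b t i * b t j)).
  by rewrite -[X in _ --> X](mulr0 0); apply: cvgM; exact: limb.
have lim1 : nH1 Om (phi t) @[t --> +oo] --> (0 : R).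
  have : Num.sqrt (bil Q (b t) (b t) + bil G (b t) (b t)) @[t --> +oo] --> (0 : R).
    by apply: sqrt0; rewrite -[X in _ --> X]addr0; apply: cvgD.
  apply: cvg_trans; apply: near_eq_cvg; near=> t.
  by rewrite (nH1E _ _ (Hb t _))//; near: t.
have lim2 : nL2 Om (du t) @[t --> +oo] --> (0 : R).
  have := sqrt0 _ limM1.
  apply: cvg_trans; apply: near_eq_cvg; near=> t.
  have t00 : 0 <= t by near: t.
  by rewrite /nL2 (ipL2_gram oOm LF LF (Ha1 t t00) (Ha1 t t00)).
have lim3 : nL2 Om (Bw Om (u t)) @[t --> +oo] --> (0 : R).
  have := sqrt0 _ limKB.
  apply: cvg_trans; apply: near_eq_cvg; near=> t.
  have t00 : 0 <= t by near: t.
  by rewrite /nL2 (ipL2_gram oOm LBF LBF (BwC _ _ (Ha t t00)) (BwC _ _ (Ha t t00))).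
split => //; exists c.
  rewrite -(cvg_lim (@Rhausdorff R) limM); apply: limr_ge; last exact: nearW.
  by apply/cvg_ex; exists c.
(* Splitting the square of [nH1B] into [M] and [KB] shows that [c] is the limit of the squared [L2]
   norm of [u] alone. *)
have : (nL2 Om (du t) ^+ 2 + (bil M (a t) (a t) + bil KB (a t) (a t)) + nH1 Om
  (phi t) ^+ 2)
    @[t --> +oo] --> 0 ^+ 2 + (c + 0) + 0 ^+ 2.
  apply: cvgD; last by apply: (continuous_cvg _ (@exprn_continuous R 2 0)).
  apply: cvgD; last exact: cvgD.
  by apply: (continuous_cvg _ (@exprn_continuous R 2 0)).
rewrite expr0n/= add0r !addr0.
apply: cvg_trans; apply: near_eq_cvg; near=> t.
have t00 : 0 <= t by near: t.
rewrite (nH1BE _ _ (Ha t t00)) [in RHS](sqr_sqrtr (_ : 0 <= bil M _ _ + _))//.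
by rewrite addr_ge0// ?psd.
Unshelve. all: by end_near. Qed.
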